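(* Suppose $X$ is sub-Gaussian with constant $C_1$ and $d\le n/(16C_3^2)$. Put $C=8C_2+8C_3^2$. Then we have the local bound $$\mathbb E[\mathcal E^{PCA}_d]\le C\sum_{\substack{j\le d:\\ \lambda_j>\lambda_{d+1}}}\frac{\lambda_j\operatorname{tr}(\Sigma)}{n(\lambda_j-\lambda_{d+1})}+C\sum_{\substack{k>d:\\ \lambda_k<\lambda_d}}\frac{\lambda_k\operatorname{tr}(\Sigma)}{n(\lambda_d-\lambda_k)}+(\lambda_d-\lambda_p)e^{-\frac{n}{32C_3^2}}$$ and the global bound $$\mathbb E[\mathcal E^{PCA}_d]\le\sum_{j\le d}\sqrt{\frac{C\lambda_j\operatorname{tr}(\Sigma)}{n}}+\sqrt{\frac{Cd\operatorname{tr}_{>d}(\Sigma)\operatorname{tr}(\Sigma)}{n}}.$$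
   Context: Let $(\mathcal H,\langle\cdot,\cdot\rangle)$ be a separable real Hilbert space of dimension $p\in\mathbb N\cup\{+\infty\}$ with norm $\|\cdot\|$, and let $X$ be a centered $\mathcal H$-valued random variable with $\mathbb E\|X\|^2<\infty$. Its covariance operator is $\Sigma=\mathbb E[X\otimes X]$, where $(u\otimes v)x=\langle v,x\rangle u$. Its eigenvalues (with multiplicity) are $\lambda_1\ge\lambda_2\ge\dots>0$, with corresponding eigenvectors $u_1,u_2,\dots$ which are assumed to form an orthonormal basis of $\mathcal H$ and are fixed; $P_j=u_j\otimes u_j$, $P_{\le d}=\sum_{j\le d}P_j$. Put $\operatorname{tr}_{>r}(\Sigma)=\sum_{j>r}\lambda_j$. For $p=\infty$ one understands $\lambda_p=0$. Let $X_1,\dots,X_n$ be $n\ge1$ independent copies of $X$, $\hat\Sigma=\frac1n\sum_{i=1}^nX_i\otimes X_i$, with eigenvalues $\hat\lambda_1\ge\hat\lambda_2\ge\dots\ge0$ and an orthonormal basis of eigenvectors $\hat u_1,\hat u_2,\dots$; $\hat P_j=\hat u_j\otimes\hat u_j$, $\hat P_{\le d}=\sum_{j\le d}\hat P_j$. $\|\cdot\|_2$ is the Hilbert-Schmidt norm, $\langle S,T\rangle=\operatorname{tr}(S^*T)$, and $\|\cdot\|_\infty$ is the operator norm. Here $d$ is an integer with $1\le d<p$. The excess risk is $\mathcal E^{PCA}_d=\langle\Sigma,P_{\le d}-\hat P_{\le d}\rangle$. $X$ is sub-Gaussian with constant $C_1$ if $\mathbb E\|X\|^2<\infty$ and $\sup_{k\ge1}k^{-1/2}\mathbb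 E[|\langle X,u\rangle|^k]^{1/k}\le C_1\mathbb E[\langle X,u\rangle^2]^{1/2}$ for all $u\in\mathcal H$. $C_2>0$ is the smallest constant such that $\mathbb E[\|P_j(\Sigma-\hat\Sigma)P_k\|_2^2]\le C_2\delta\lambda_j\lambda_k/n$ for all $j,k$, with $\delta=1$ if $j\ne k$ and $\delta=2$ if $j=k$. $C_3>1$ is a constant depending only on $C_1$ such that for every centered sub-Gaussian random variable with constant $C_1$ in a separable Hilbert space, with covariance $\Sigma$, largest eigenvalue $\lambda_1$ of $\Sigma$, and sample covariance $\hat\Sigma$ from $n$ independent copies, one has $\mathbb P(\|\Sigma-\hat\Sigma\|_\infty>C_3\lambda_1x)\le e^{-n(x\wedge x^2)}$ whenever $x>0$ and $\operatorname{tr}(\Sigma)\le n\lambda_1(x\wedge x^2)$ (the existence of such $C_3$ is a known theorem of Koltchinskii and Lounici). *)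

(* Defs.v *)
From HB Require Import structures.
From mathcomp Require Import all_boot all_order all_algebra sesquilinear.
From mathcomp Require Import all_classical all_reals all_analysis.

Set Implicit Arguments.
Unset Strict Implicit.
Unset Printing Implicit Defensive.

Import Order.TTheory GRing.Theory Num.Theory.
Import numFieldNormedType.Exports.

Local Open Scope classical_set_scope.
Local Open Scope ring_scope.

(* A real Hilbert space is a [completeNormedModType R] H together with a
   positive definite symmetric form [ip : {dot H for idfun}] that induces the
   norm. Its dimension is [p : option nat], where [None] stands for +oo.
   Indices start at 0: lambda_j, u_j, P_j of the usual 1-based notation are
   [lam j.-1], [u j.-1], and so on. Thus [in_dim p j] means that the (j+1)-st
   basis vector exists; families are indexed by all of nat and their values
   outside [in_dim p] are never used. *)
Definition in_dim (p : option nat) (j : nat) : bool :=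
  if p is Some m then (j < m)%N else true.

Section hilbert.
Context {R : realType} {H : completeNormedModType R}.
Variable ip : {dot H for idfun}.

Definition hilbert_norm : Prop := forall v : H, ip v v = `|v| ^+ 2.

(* The existence of such a family also makes H separable. *)
Definition orthonormal_basis (p : option nat) (e : nat -> H) : Prop :=
  (forall i j, in_dim p i -> in_dim p j -> ip (e i) (e j) = (i == j)%:R) /\
  (forall v : H,
     (fun N => \sum_(j < N | in_dim p j) ip v (e j) *: e j) @ \oo --> v).

(* (a (x) b) v = <b, v> a *)
Definition tens (a b : H) : H -> H := fun v => ip b v *: a.

(* The trace of a trace class operator, computed in an orthonormal basis e
   (on which its value does not depend). *)
Definition trace (p : option nat) (e : nat -> H) (T : H -> H) : R :=
  limn (fun N => \sum_(j < N | in_dim p j) ip (T (e j)) (e j)).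

(* <S, T> = tr (S^* T), computed in an orthonormal basis e: the diagonal
   entries of S^* T are <e_j, S^* T e_j> = <S e_j, T e_j>. *)
Definition hs_dot (p : option nat) (e : nat -> H) (S T : H -> H) : R :=
  limn (fun N => \sum_(j < N | in_dim p j) ip (S (e j)) (T (e j))).

Definition hs_norm (p : option nat) (e : nat -> H) (T : H -> H) : R :=
  Num.sqrt (hs_dot p e T T).

Definition op_norm (T : H -> H) : R :=
  sup [set `|T v| | v in [set v : H | `|v| <= 1]].

Definition is_eigenvalue (T : H -> H) (a : R) : Prop :=
  exists2 v : H, v != 0 & T v = a *: v.

Definition largest_eigenvalue (T : H -> H) (a : R) : Prop :=
  is_eigenvalue T a /\ forall b, is_eigenvalue T b -> b <= a.

Definition spectral_decomposition (p : option nat) (T : H -> H)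
    (l : nat -> R) (e : nat -> H) : Prop :=
  [/\ orthonormal_basis p e,
      forall j, in_dim p j -> T (e j) = l j *: e j
    & forall i j, (i <= j)%N -> in_dim p j -> l j <= l i].

Definition proj (e : nat -> H) (j : nat) : H -> H := tens (e j) (e j).

(* P_{<= d} *)
Definition proj_le (e : nat -> H) (d : nat) : H -> H :=
  fun v => \sum_(j < d) proj e j v.

(* lambda_p, which is 0 by convention when p = +oo *)
Definition last_eigenvalue (p : option nat) (l : nat -> R) : R :=
  if p is Some m then l m.-1 else 0.

(* tr_{> r} *)
Definition tail_trace (p : option nat) (l : nat -> R) (r : nat) : R :=
  limn (fun N => \sum_(r <= j < N | in_dim p j) l j).

Definition borel_set (B : set H) : Prop := <<s @open H >> B.

Definition borel_measurable {disp} {Omega : measurableType disp}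
    (Y : Omega -> H) : Prop :=
  measurable_fun setT (Y : Omega -> g_sigma_algebraType (@open H)).

Section random.
Context {disp : measure_display} {Omega : measurableType disp}.
Variable P : probability Omega R.

(* m is the expectation of the H-valued random variable Y, in the weak sense *)
Definition is_mean (Y : Omega -> H) (m : H) : Prop :=
  forall v : H, P.-integrable setT (EFin \o (fun w => ip (Y w) v)) /\
    ('E_P[fun w => ip (Y w) v] = (ip m v)%:E)%E.

(* S = E[X (x) X] *)
Definition is_covariance (X : Omega -> H) (S : H -> H) : Prop :=
  forall v : H, is_mean (fun w => tens (X w) (X w) v) (S v).

Definition square_integrable (X : Omega -> H) : Prop :=
  ('E_P[fun w => (`|X w| ^+ 2)%R] < +oo)%E.

Definition sub_gaussian (C1 : R) (X : Omega -> H) : Prop :=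
  square_integrable X /\
  forall v : H,
    (ereal_sup [set ((Num.sqrt k%:R)^-1)%:E *
                    ('E_P[fun w => (`|ip (X w) v| ^+ k)%R] `^ (k%:R^-1))
               | k in [set k | (1 <= k)%N]]
     <= C1%:E * ('E_P[fun w => (ip (X w) v ^+ 2)%R] `^ (2^-1)))%E.

Definition independent_copies (X : Omega -> H) (n : nat)
    (Xs : 'I_n -> Omega -> H) : Prop :=
  [/\ forall i, borel_measurable (Xs i),
      forall i (B : set H), borel_set B ->
        P (Xs i @^-1` B) = P (X @^-1` B)
    & forall B : 'I_n -> set H, (forall i, borel_set (B i)) ->
        P [set w | forall i, B i (Xs i w)] =
        (\prod_(i < n) P (Xs i @^-1` B i))%E].

Definition sample_covariance (n : nat) (Xs : 'I_n -> Omega -> H)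
    (w : Omega) : H -> H :=
  fun v => n%:R^-1 *: \sum_(i < n) tens (Xs i w) (Xs i w) v.

Definition fourth_moment_bound (p : option nat) (u : nat -> H)
    (lam : nat -> R) (Sigma : H -> H) (n : nat) (Xs : 'I_n -> Omega -> H)
    (c : R) : Prop :=
  forall j k, in_dim p j -> in_dim p k ->
    ('E_P[fun w => (hs_norm p u (proj u j \o
            (Sigma \- sample_covariance Xs w) \o proj u k) ^+ 2)%R]
     <= (c * (if j == k then 2 else 1) * lam j * lam k / n%:R)%:E)%E.

(* C_2 *)
Definition smallest_fourth_moment_constant (p : option nat) (u : nat -> H)
    (lam : nat -> R) (Sigma : H -> H) (n : nat) (Xs : 'I_n -> Omega -> H)
    (c : R) : Prop :=
  [/\ 0 < c, fourth_moment_bound p u lam Sigma Xs c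
    & forall c', 0 < c' -> fourth_moment_bound p u lam Sigma Xs c' -> c <= c'].

(* The excess risk <Sigma, P_{<= d} - hat P_{<= d}>; u is the eigenbasis of
   Sigma and hu w that of the sample covariance at the outcome w. *)
Definition excess_risk (p : option nat) (Sigma : H -> H) (u : nat -> H)
    (hu : Omega -> nat -> H) (d : nat) (w : Omega) : R :=
  hs_dot p u Sigma (proj_le u d \- proj_le (hu w) d).

End random.
End hilbert.

(* The Koltchinskii-Lounici inequality, which C_3 satisfies for all centered
   random variables that are sub-Gaussian with constant C_1. *)
Definition koltchinskii_lounici (R : realType) (C1 C3 : R) : Prop :=
  forall (H : completeNormedModType R) (ip : {dot H for idfun})
    (p : option nat) (e : nat -> H)
    (disp : measure_display) (Omega : measurableType disp)
    (P : probability Omega R) (X : Omega -> H) (Sigma : H -> H) (lam1 : R)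
    (n : nat) (Xs : 'I_n -> Omega -> H) (x : R),
  hilbert_norm ip -> orthonormal_basis ip p e ->
  borel_measurable X -> is_mean ip P X 0 -> sub_gaussian ip P C1 X ->
  is_covariance ip P X Sigma -> largest_eigenvalue Sigma lam1 ->
  (1 <= n)%N -> independent_copies P X Xs ->
  0 < x ->
  trace ip p e Sigma <= n%:R * lam1 * Num.min x (x ^+ 2) ->
  (P [set w | (C3 * lam1 * x < op_norm (Sigma \- sample_covariance ip Xs w))%R]
   <= (expR (- (n%:R * Num.min x (x ^+ 2))))%:E)%E.

(* Main.v *)
(* Fix mu = lambda_{d+1} and let a_j be the squared norm of the projection of u_j
   onto the span of hat u_1, ..., hat u_d, so that sum_j a_j = d. Then
     excess risk = sum_{j <= d} (lambda_j - mu) (1 - a_j)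
                   + sum_{k > d} (mu - lambda_k) a_k.
   With Delta = Sigma - hat Sigma one has
   <Delta u_j, hat u_i> = (lambda_j - hat lambda_i) <u_j, hat u_i>. Hence, as long
   as hat lambda_{d+1} <= (lambda_j + mu) / 2, Bessel's inequality gives
   1 - a_j <= 4 |Delta u_j|^2 / (lambda_j - mu)^2, and symmetrically
   a_k <= 4 |Delta u_k|^2 / (lambda_d - lambda_k)^2 as long as
   hat lambda_d >= (lambda_d + lambda_k) / 2. The definition of C_2 bounds
   E |Delta u_j|^2 by 2 C_2 lambda_j tr(Sigma) / n.

   The exceptional events are controlled by min-max and the Koltchinskii-Lounici
   inequality, applied to P_{>d} X for hat lambda_{d+1} and to the whitened vector
   Sigma^{-1/2} P_{<=d} X for hat lambda_d. For the latter the trace is d and the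
   largest eigenvalue is 1, which yields a multiplicative lower bound on
   hat lambda_d; the event hat lambda_d < 3 lambda_d / 4 has probability at most
   exp(-n / (16 C_3^2)) because d <= n / (16 C_3^2). The global bound follows from
   the same estimates by replacing each x / g with min(g, x / g) <= sqrt x in the
   first sum and by the Cauchy-Schwarz inequality in the second. *)

Require Import Defs.
From mathcomp Require Import all_boot all_order all_algebra sesquilinear.
From mathcomp Require Import all_classical all_reals all_analysis.
From mathcomp Require Import measurable_realfun zify ring lra.

Set Implicit Arguments.
Unset Strict Implicit.
Unset Printing Implicit Defensive.

Import Order.TTheory GRing.Theory Num.Theory.
Import numFieldNormedType.Exports.

Local Open Scope classical_set_scope.
Local Open Scope ring_scope.

(** * Inner products and orthonormal bases *)

Section inner_product.
Context {R : realType} {H : completeNormedModType R} (ip : {dot H for idfun}).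
Implicit Types (a : R) (v w x : H).

Lemma ipC v w : ip v w = ip w v.
Proof. by rewrite hermC expr0 mul1r. Qed.

Lemma ipDl v w x : ip (v + w) x = ip v x + ip w x.
Proof. exact: linearDl. Qed.

Lemma ipZl a v x : ip (a *: v) x = a * ip v x.
Proof. exact: linearZl_LR. Qed.

Lemma ipDr v w x : ip x (v + w) = ip x v + ip x w.
Proof. by rewrite ipC ipDl !(ipC _ x). Qed.

Lemma ipZr a v x : ip x (a *: v) = a * ip x v.
Proof. by rewrite ipC ipZl ipC. Qed.

Lemma ip0l x : ip 0 x = 0.
Proof. by rewrite -(scale0r x) ipZl mul0r. Qed.

Lemma ip0r x : ip x 0 = 0.
Proof. by rewrite ipC ip0l. Qed.

Lemma ipNl v x : ip (- v) x = - ip v x.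
Proof. by rewrite -scaleN1r ipZl mulN1r. Qed.

Lemma ipNr v x : ip x (- v) = - ip x v.
Proof. by rewrite ipC ipNl ipC. Qed.

Lemma ipBl v w x : ip (v - w) x = ip v x - ip w x.
Proof. by rewrite ipDl ipNl. Qed.

Lemma ipBr v w x : ip x (v - w) = ip x v - ip x w.
Proof. by rewrite ipDr ipNr. Qed.

Lemma ip_suml (I : Type) (r : seq I) (Q : pred I) (F : I -> H) x :
  ip (\sum_(i <- r | Q i) F i) x = \sum_(i <- r | Q i) ip (F i) x.
Proof. by elim/big_rec2 : _ => [|i b c _ <-]; rewrite ?ip0l// ipDl. Qed.

Lemma ip_sumr (I : Type) (r : seq I) (Q : pred I) (F : I -> H) x :
  ip x (\sum_(i <- r | Q i) F i) = \sum_(i <- r | Q i) ip x (F i).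
Proof. by rewrite ipC ip_suml; apply: eq_bigr => i _; rewrite ipC. Qed.

Hypothesis ip_norm : hilbert_norm ip.

Lemma ip_cauchy_schwarz v w : `|ip v w| <= `|v| * `|w|.
Proof.
have [->|w0] := eqVneq w 0; first by rewrite ip0r !normr0 mulr0.
have w2 : 0 < `|w| ^+ 2 by rewrite exprn_gt0// normr_gt0.
(* The residual of [v] after projection onto the line of [w] has nonnegative squared norm. *)
have : 0 <= ip (v - (ip v w / `|w| ^+ 2) *: w) (v - (ip v w / `|w| ^+ 2) *: w).
  by rewrite ip_norm sqr_ge0.
rewrite ipBl !ipBr !ipZl !ipZr !ip_norm (ipC w v).
set q := ip v w; set b := `|w| ^+ 2 in w2 * => h.
have {}h : 0 <= `|v| ^+ 2 - q ^+ 2 / b.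
  apply: le_trans h _; rewrite le_eqVlt; apply/orP; left; apply/eqP.
  by field; rewrite gt_eqF.
move: h; rewrite subr_ge0 ler_pdivrMr// => h.
rewrite -(@ler_pXn2r _ 2)// ?nnegrE ?mulr_ge0//.
by rewrite exprMn real_normK ?num_real.
Qed.

Lemma ip_cvgl (T : Type) (F : set_system T) {FF : Filter F} (f : T -> H) v x :
  f @ F --> v -> ip (f t) x @[t --> F] --> ip v x.
Proof.
move=> fv; apply/cvgrPdist_lt => e e0.
(* The [+ 1] keeps the divisor positive when [x = 0]. *)
have x1 : 0 < `|x| + 1 by rewrite ltr_wpDl.
have /cvgrPdist_lt /(_ (e / (`|x| + 1))) := fv.
move=> /(_ (divr_gt0 e0 x1)); apply: filterS => t.
rewrite -ipBl ltr_pdivlMr// => h.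
apply: le_lt_trans (ip_cauchy_schwarz _ _) _; apply: le_lt_trans h.
by rewrite ler_wpM2l// lerDl.
Qed.

Lemma continuous_ip x : continuous (ip^~ x).
Proof. by move=> v; apply: ip_cvgl. Qed.

Section basis.
Context (p : option nat) (e : nat -> H) (e_basis : orthonormal_basis ip p e).

Lemma basis_norm2 k : in_dim p k -> ip (e k) (e k) = 1.
Proof. by move=> pk; rewrite e_basis.1// eqxx. Qed.

Lemma basis_ip_sum (N k : nat) (c : nat -> R) : in_dim p k ->
  ip (\sum_(j < N | in_dim p j) c j *: e j) (e k) = if (k < N)%N then c k else 0.
Proof.
move=> pk; rewrite ip_suml; case: ifPn => [kN|kN].
  rewrite (bigD1 (Ordinal kN))//= big1 ?addr0.
    by rewrite ipZl basis_norm2// mulr1.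
  move=> i /andP[pi iN]; rewrite ipZl e_basis.1//.
  suff /negbTE -> : (i : nat) != k by rewrite mulr0.
  by apply: contra iN => /eqP ik; apply/eqP/val_inj.
apply: big1 => i pi; rewrite ipZl e_basis.1//.
suff /negbTE -> : (i : nat) != k by rewrite mulr0.
by apply: contra kN => /eqP <-.
Qed.

Lemma basis_norm2_sum (N : nat) (c : nat -> R) :
  `|\sum_(j < N | in_dim p j) c j *: e j| ^+ 2 = \sum_(j < N | in_dim p j) c j ^+ 2.
Proof.
rewrite -ip_norm ip_sumr; apply: eq_bigr => i pi.
by rewrite ipZr basis_ip_sum// ltn_ord expr2.
Qed.

Lemma parseval v w :
  (fun N => \sum_(j < N | in_dim p j) ip v (e j) * ip w (e j)) @ \oo --> ip v w.
Proof.
refine (cvg_trans _ (ip_cvgl (x := w) (e_basis.2 v))).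
apply: near_eq_cvg; apply: nearW => N /=.
by rewrite ip_suml; apply: eq_bigr => i _; rewrite ipZl (ipC w).
Qed.

Lemma parseval2 v :
  (fun N => \sum_(j < N | in_dim p j) ip v (e j) ^+ 2) @ \oo --> `|v| ^+ 2.
Proof. by rewrite -ip_norm; exact: parseval. Qed.

Lemma bessel v N : \sum_(j < N | in_dim p j) ip v (e j) ^+ 2 <= `|v| ^+ 2.
Proof.
rewrite -(cvg_lim _ (@parseval2 v))//.
apply: (nondecreasing_cvgn_le (u_ := fun N => \sum_(j < N | in_dim p j) ip v (e j) ^+ 2)).
  apply/nondecreasing_seqP => m; rewrite [leRHS]big_mkcond big_ord_recr/= -big_mkcond/=.
  by rewrite lerDl; case: ifP => // _; rewrite sqr_ge0.
by apply/cvg_ex; eexists; exact: parseval2.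
Qed.

Lemma parseval_series v :
  (\sum_(0 <= j <oo | in_dim p j) (ip v (e j) ^+ 2)%:E = (`|v| ^+ 2)%:E)%E.
Proof.
apply: cvg_lim => //.
have /(cvg_comp _ EFin) h := @parseval2 v.
refine (cvg_trans _ (h _ _)); last exact: cvg_id.
apply: near_eq_cvg; apply: nearW => N /=.
by rewrite big_mkord sumEFin.
Qed.

Lemma basis_ext v w : (forall k, in_dim p k -> ip v (e k) = ip w (e k)) -> v = w.
Proof.
move=> vw; apply/eqP; rewrite -subr_eq0 -normr_eq0 -sqrf_eq0; apply/eqP.
rewrite -(cvg_lim _ (@parseval2 (v - w)))//.
rewrite (_ : (fun N => _) = (fun=> 0)) ?lim_cst//.
apply/funext => N; apply: big1 => i pi.
by rewrite ipBl vw// subrr expr0n.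
Qed.

End basis.
End inner_product.

Arguments ip_cvgl {R H ip} ip_norm {T F FF f v} x _.
Arguments parseval {R H ip} ip_norm {p e} e_basis v w.
Arguments parseval2 {R H ip} ip_norm {p e} e_basis v.

(** * Min-max bounds for eigenvalues *)

Lemma in_dim_le p i j : (i <= j)%N -> in_dim p j -> in_dim p i.
Proof. by case: p => //= m; exact: leq_ltn_trans. Qed.

(** A system with more unknowns than equations has a nonzero solution: the rank of the matrix is at
    most [m < m.+1]. *)
Lemma homogeneous_system_solution (F : fieldType) m (M : nat -> nat -> F) :
  exists2 c : nat -> F, (exists i, (i < m.+1)%N /\ c i != 0) &
    forall j, (j < m)%N -> \sum_(i < m.+1) c i * M i j = 0.
Proof.
pose A : 'M[F]_(m.+1, m) := \matrix_(i, j) M i j.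
have /rowV0Pn[v /sub_kermxP vA /rV0Pn[i vi]] : kermx A != 0.
  by rewrite kermx_eq0 /row_free neq_ltn (leq_ltn_trans (rank_leq_col A)).
exists (fun k => v 0 (inord k)); first by exists i; rewrite inord_val.
move=> j jm; have /rowP/(_ (Ordinal jm)) := vA; rewrite !mxE => vAj.
rewrite -[RHS]vAj; apply: eq_bigr => k _; rewrite inord_val !mxE.
by [].
Qed.

Section spectral.
Context {R : realType} {H : completeNormedModType R} (ip : {dot H for idfun}).
Hypothesis ip_norm : hilbert_norm ip.

(** Operators are bare functions; their linearity is recovered from this identity, because the form
    separates points. *)
Definition self_adjoint (T : H -> H) : Prop := forall v w, ip (T v) w = ip v (T w).

Context (p : option nat) (T : H -> H) (l : nat -> R) (e : nat -> H).
Hypothesis T_spec : spectral_decomposition ip p T l e.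
Hypothesis T_sa : self_adjoint T.

Let e_basis : orthonormal_basis ip p e. Proof. by case: T_spec. Qed.

Lemma spectral_ip v k : in_dim p k -> ip (T v) (e k) = l k * ip v (e k).
Proof. by case: T_spec => _ Te _ pk; rewrite T_sa Te// ipZr. Qed.

Lemma spectral_quad_le v m b :
  (forall k, (k < m)%N -> in_dim p k -> ip v (e k) = 0) ->
  (forall k, (m <= k)%N -> in_dim p k -> l k <= b) ->
  ip (T v) v <= b * `|v| ^+ 2.
Proof.
move=> v0 lb.
have h1 := parseval ip_norm e_basis (T v) v.
have h2 : b * (\sum_(j < N | in_dim p j) ip v (e j) ^+ 2) @[N --> \oo] --> b * `|v| ^+ 2.
  by apply: cvgM; [exact: cvg_cst|exact: parseval2].
refine (ler_cvg_to h1 h2 _); apply: nearW => N /=.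
rewrite mulr_sumr; apply: ler_sum => k pk; rewrite spectral_ip//.
have [km|mk] := ltnP k m; first by rewrite v0// expr2 !mulr0.
by rewrite -mulrA -expr2 ler_wpM2r ?sqr_ge0 ?lb.
Qed.

Lemma spectral_span_quad (m : nat) (c : nat -> R) :
  let v := \sum_(i < m | in_dim p i) c i *: e i in
  ip (T v) v = \sum_(i < m | in_dim p i) l i * c i ^+ 2.
Proof.
move=> v; rewrite {2}/v ip_sumr; apply: eq_bigr => i pi.
by rewrite ipZr spectral_ip// basis_ip_sum// ltn_ord; ring.
Qed.

(** The [m.+1] coefficients are subject to only [m] orthogonality conditions; [in_dim p m] ensures
    that all [m.+1] basis vectors exist. *)
Lemma span_orthogonal_vector (g f : nat -> H) (m : nat) :
  orthonormal_basis ip p g -> in_dim p m ->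
  exists c : nat -> R, let v := \sum_(i < m.+1 | in_dim p i) c i *: g i in
    0 < `|v| ^+ 2 /\ forall j, (j < m)%N -> ip v (f j) = 0.
Proof.
move=> g_basis pm.
have [c [i [im ci]] cM] := @homogeneous_system_solution R m (fun i j => ip (g i) (f j)).
have inm (k : 'I_m.+1) : in_dim p k by apply: in_dim_le pm; rewrite -ltnS.
exists c; split.
  rewrite (basis_norm2_sum ip_norm g_basis) (bigD1 (Ordinal im)) ?inm//=.
  by rewrite ltr_pwDl// ?sumr_ge0// => [|k _]; rewrite ?sqr_ge0// exprn_even_gt0.
move=> j jm; rewrite ip_suml -[RHS](cM j jm).
under eq_bigl do rewrite inm.
by apply: eq_bigr => k _; rewrite ipZl.
Qed.

(** Upper half of the Courant-Fischer principle: some nonzero vector in the span of [e 0, ..., e m]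
    is orthogonal to the first [m] vectors [f j], and its Rayleigh quotient is at least [l m]. *)
Lemma eigenvalue_le (f : nat -> H) (m : nat) (b : R) : in_dim p m ->
  (forall v, (forall j, (j < m)%N -> ip v (f j) = 0) -> ip (T v) v <= b * `|v| ^+ 2) ->
  l m <= b.
Proof.
move=> pm Tb; have [c [v0 vf]] := span_orthogonal_vector f e_basis pm.
have := Tb _ vf; set v := \sum_(_ < _ | _) _ in v0 vf *.
move=> {}Tb; rewrite -(ler_pM2r v0); apply: le_trans Tb.
rewrite /v spectral_span_quad (basis_norm2_sum ip_norm e_basis) mulr_sumr.
apply: ler_sum => i pi; rewrite ler_wpM2r ?sqr_ge0//.
by case: T_spec => _ _; apply=> //; rewrite -ltnS.
Qed.

(** Lower half: some nonzero vector in the span of [f 0, ..., f m] is orthogonal to the first [m]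
    eigenvectors, and its Rayleigh quotient is at most [l m]. *)
Lemma le_eigenvalue (f : nat -> H) (m : nat) (b : R) : in_dim p m ->
  orthonormal_basis ip p f ->
  (forall c : nat -> R, let v := \sum_(i < m.+1 | in_dim p i) c i *: f i in
     b * `|v| ^+ 2 <= ip (T v) v) ->
  b <= l m.
Proof.
move=> pm f_basis Tb; have [c [v0 ve]] := span_orthogonal_vector e f_basis pm.
have := Tb c; rewrite /=; set v := \sum_(_ < _ | _) _ in v0 ve *.
move=> {}Tb; rewrite -(ler_pM2r v0); apply: le_trans Tb _.
apply: (spectral_quad_le (m := m)) => [k km _|k mk pk]; first exact: ve.
by case: T_spec => _ _; apply.
Qed.

End spectral.

(** * Bounded self-adjoint operators *)

Section operators.
Context {R : realType} {H : completeNormedModType R} (ip : {dot H for idfun}).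
Hypothesis ip_norm : hilbert_norm ip.
Implicit Types T A : H -> H.

Definition bounded_op T : Prop := exists2 M, 0 <= M & forall v : H, `|T v| <= M * `|v|.

Lemma ip_inj v w : (forall x, ip v x = ip w x) -> v = w.
Proof.
move=> vw; apply/eqP; rewrite -subr_eq0 -normr_eq0 -sqrf_eq0 -ip_norm.
by rewrite ipBl vw subrr.
Qed.

Lemma self_adjoint0 T : self_adjoint ip T -> T 0 = 0.
Proof. by move=> sT; apply: ip_inj => x; rewrite sT !ip0l. Qed.

Lemma self_adjointZ T : self_adjoint ip T -> forall a v, T (a *: v) = a *: T v.
Proof. by move=> sT a v; apply: ip_inj => x; rewrite sT !ipZl sT. Qed.

Lemma self_adjointB T : self_adjoint ip T -> forall v w, T (v - w) = T v - T w.
Proof. by move=> sT v w; apply: ip_inj => x; rewrite sT !ipBl !sT. Qed.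

Lemma self_adjoint_sub T A : self_adjoint ip T -> self_adjoint ip A ->
  self_adjoint ip (T \- A).
Proof. by move=> sT sA v w; rewrite /= ipBl ipBr sT sA. Qed.

Lemma self_adjoint_conj T A : self_adjoint ip T -> self_adjoint ip A ->
  self_adjoint ip (A \o T \o A).
Proof. by move=> sT sA v w; rewrite /= sA sT sA. Qed.

Lemma bounded_op_sub T A : bounded_op T -> bounded_op A -> bounded_op (T \- A).
Proof.
move=> [M M0 TM] [N N0 AN]; exists (M + N); first exact: addr_ge0.
move=> v; rewrite mulrDl; apply: le_trans (ler_normB _ _) _.
by rewrite lerD.
Qed.

Lemma bounded_op_comp T A : bounded_op T -> bounded_op A -> bounded_op (T \o A).
Proof.
move=> [M M0 TM] [N N0 AN]; exists (M * N); first exact: mulr_ge0.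
move=> v; apply: le_trans (TM _) _.
by rewrite -mulrA ler_wpM2l.
Qed.

Lemma bounded_op_continuous T : self_adjoint ip T -> bounded_op T -> continuous T.
Proof.
move=> sT [M M0 TM] x; apply/cvgrPdist_lt => e e0.
have M1 : 0 < M + 1 by rewrite ltr_wpDl.
have /cvgrPdist_lt /(_ (e / (M + 1)) (divr_gt0 e0 M1)) : id y @[y --> x] --> x by exact: cvg_id.
apply: filterS => k; rewrite ltr_pdivlMr// => h.
rewrite -self_adjointB//; apply: le_lt_trans (TM _) _; apply: le_lt_trans h.
by rewrite mulrC ler_wpM2l// lerDl.
Qed.

(** A real [sup] is meaningful only on a nonempty set bounded above; the later facts about [op_norm]
    rest on this. *)
Lemma op_norm_has_sup T : bounded_op T ->
  has_sup [set `|T v| | v in [set v : H | `|v| <= 1]].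
Proof.
move=> [M M0 TM]; split; first by exists `|T 0|, 0 => //=; rewrite normr0.
exists M => _ [v /= v1 <-]; apply: le_trans (TM v) _.
by rewrite ler_piMr.
Qed.

Lemma le_op_norm T v : self_adjoint ip T -> bounded_op T -> `|T v| <= op_norm T * `|v|.
Proof.
move=> sT bT; have [->|v0] := eqVneq v 0.
  by rewrite self_adjoint0// !normr0 mulr0.
have nv0 : 0 < `|v| by rewrite normr_gt0.
rewrite -ler_pdivrMr//.
apply: ub_le_sup; first exact: (op_norm_has_sup bT).2.
exists (`|v|^-1 *: v); rewrite /=.
  by rewrite normrZ normfV normr_id mulVf// gt_eqF.
by rewrite self_adjointZ// normrZ normfV normr_id mulrC.
Qed.

Lemma op_norm_quad T v : self_adjoint ip T -> bounded_op T ->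
  `|ip (T v) v| <= op_norm T * `|v| ^+ 2.
Proof.
move=> sT bT; apply: le_trans (ip_cauchy_schwarz ip_norm _ _) _.
by rewrite expr2 mulrA ler_wpM2r ?le_op_norm.
Qed.

Lemma op_norm_gtP T c : self_adjoint ip T -> bounded_op T -> 0 <= c ->
  c < op_norm T <-> exists v, c * `|v| < `|T v|.
Proof.
move=> sT bT c0; split.
  move=> /(sup_gt (op_norm_has_sup bT).1)[_ [v /= v1 <-] cv].
  by exists v; apply: le_lt_trans cv; rewrite ler_piMr.
move=> [v cv]; have v0 : 0 < `|v|.
  rewrite normr_gt0; apply: contraPneq cv => ->.
  by rewrite self_adjoint0// normr0 mulr0 ltxx.
by rewrite -(ltr_pM2r v0); apply: lt_le_trans cv _; exact: le_op_norm.
Qed.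

(** The index type [seq rat] is countable; the length of the list is the order of truncation. *)
Definition rat_comb (p : option nat) (e : nat -> H) (s : seq rat) : H :=
  \sum_(j < size s | in_dim p j) (ratr (nth 0 s j) : R) *: e j.

Lemma rat_comb_dense p e v (eps : R) : orthonormal_basis ip p e -> 0 < eps ->
  exists s, `|v - rat_comb p e s| < eps.
Proof.
move=> e_basis e0; have [_ /(_ v)] := e_basis.
move=> /cvgrPdist_lt /(_ (eps / 2) (divr_gt0 e0 (ltr0Sn _ 1))) [N _ /(_ N (leqnn N))] /= vN.
(* Half of [eps] pays for truncation, half for rounding at most [N] coefficients; [N.+1] avoids a
   division by zero. *)
pose eta := eps / 2 / N.+1%:R.
have eta0 : 0 < eta by rewrite !divr_gt0.
have /choice[q qP] : forall j, exists q : rat, `|ip v (e j) - ratr q| < eta.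
  move=> j; have [q] := @rat_in_itvoo R (ip v (e j) - eta) (ip v (e j) + eta) ltac:(lra).
  by rewrite in_itv/= => h; exists q; rewrite ltr_norml; lra.
exists (mkseq q N); rewrite /rat_comb size_mkseq.
set w := \sum_(_ < _ | _) _ in vN; set z := \sum_(_ < _ | _) _.
have wz : `|w - z| <= eps / 2.
  rewrite /w /z -sumrB; apply: le_trans (ler_norm_sum _ _ _) _.
  apply: (@le_trans _ _ (\sum_(j < N | in_dim p j) eta)).
    apply: ler_sum => j pj; rewrite -scalerBl normrZ nth_mkseq// -[leRHS]mulr1.
    have -> : `|e j| = 1.
      by apply/eqP; rewrite -sqrp_eq1// -ip_norm (basis_norm2 e_basis).
    by rewrite ler_wpM2r// ltW.
  rewrite sumr_const -[leLHS]mulr_natr /eta mulrAC -mulrA ler_piMr//; first by lra.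
  rewrite ler_pdivrMr// mul1r ler_nat (leq_trans (max_card _))// card_ord.
  by rewrite leqnSn.
rewrite -(subrKA w); apply: le_lt_trans (ler_normD _ _) _.
lra.
Qed.

(** Both sides of the strict inequality are continuous in the vector, so it passes from [v] to a
    close enough rational combination. *)
Lemma op_norm_gt_rat p e T c : orthonormal_basis ip p e ->
  self_adjoint ip T -> bounded_op T -> 0 <= c ->
  c < op_norm T <-> exists s, c * `|rat_comb p e s| < `|T (rat_comb p e s)|.
Proof.
move=> e_basis sT bT c0; rewrite op_norm_gtP//; split=> [[v cv]|[s cs]].
  2: by eexists; exact: cs.
have /choice[s sv] : forall k : nat, exists s, `|v - rat_comb p e s| < k.+1%:R^-1.
  by move=> k; apply: rat_comb_dense; rewrite ?invr_gt0.
have sv_cvg : rat_comb p e (s k) @[k --> \oo] --> v.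
  apply/cvgrPdist_lt => eps eps0.
  have := near_infty_natSinv_lt (PosNum eps0); apply: filterS => k /=.
  exact: lt_trans.
have : `|T (rat_comb p e (s k))| - c * `|rat_comb p e (s k)| @[k --> \oo] --> `|T v| - c * `|v|.
  apply: cvgB.
    by apply: cvg_norm; apply: continuous_cvg => //; exact: bounded_op_continuous.
  by apply: cvgM; [exact: cvg_cst|exact: cvg_norm].
move=> /cvgrPdist_lt /(_ (`|T v| - c * `|v|)); rewrite subr_gt0 => /(_ cv).
move=> [N _ /(_ N (leqnn N))] /= h; exists (s N).
by move: h; rewrite ltr_norml => /andP[_]; lra.
Qed.

(* The value of a probability on a nonmeasurable set is junk, so the events of
   [koltchinskii_lounici] have to be proved measurable; the supremum in [op_norm]
   is reduced to a countable one by density of the rational combinations. *)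
Section measurable_op_norm.
Context (disp : measure_display) (Omega : measurableType disp) (T : Omega -> H -> H).
Hypothesis T_sa : forall w, self_adjoint ip (T w).
Hypothesis T_bounded : forall w, bounded_op (T w).
Hypothesis T_meas : forall v, measurable_fun setT (fun w => `|T w v|).

Lemma measurable_op_norm_gt p e c : orthonormal_basis ip p e -> 0 <= c ->
  measurable [set w | c < op_norm (T w)].
Proof.
move=> e_basis c0.
pose F n := if unpickle n is Some s
  then [set w | c * `|rat_comb p e s| < `|T w (rat_comb p e s)|] else set0.
rewrite (_ : mkset _ = \bigcup_n F n).
  apply: bigcupT_measurable => n; rewrite /F; case: unpickle => // s.
  rewrite -[X in measurable X]setTI.
  have := @measurable_fun_ltr _ _ _ setT (cst (c * `|rat_comb p e s|)) _
    (measurable_cst _) (T_meas (rat_comb p e s)).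
  by move=> /(_ measurableT [set true]) /(_ Logic.I); congr measurable.
apply/seteqP; split=> [w /= /(op_norm_gt_rat e_basis (T_sa w) (T_bounded w) c0)[s cs]|w [n _]].
  by exists (pickle s) => //; rewrite /F pickleK.
rewrite /F; case: unpickle => // s cs.
by apply/(op_norm_gt_rat e_basis (T_sa w) (T_bounded w) c0); exists s.
Qed.

End measurable_op_norm.

End operators.

(** * Random vectors and covariance operators *)

Section borel.
Context {R : realType} {H : completeNormedModType R}.
Context {disp : measure_display} {Omega : measurableType disp}.

Lemma borel_set_preimage (A : H -> H) (B : set H) :
  continuous A -> borel_set B -> borel_set (A @^-1` B).
Proof.
move=> /continuousP cA bB; rewrite -[X in borel_set X]setTI.
have : measurable_fun (setT : set (g_sigma_algebraType (@open H)))
    (A : g_sigma_algebraType (@open H) -> g_sigma_algebraType (@open H)).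
  apply: (@measurability _ _ (g_sigma_algebraType (@open H))
    (g_sigma_algebraType (@open H)) setT A (@open H) erefl) => _ [U oU <-].
  by rewrite setTI; apply: sub_sigma_algebra; exact: cA.
by move=> /(_ measurableT B bB).
Qed.

Lemma borel_measurable_comp (A : H -> H) (Y : Omega -> H) :
  continuous A -> borel_measurable Y -> borel_measurable (A \o Y).
Proof.
by move=> cA mY _ B bB; exact: (mY measurableT _ (borel_set_preimage cA bB)).
Qed.

Lemma borel_measurable_real (f : H -> R) (Y : Omega -> H) :
  continuous f -> borel_measurable Y -> measurable_fun setT (f \o Y).
Proof.
move=> /continuousP cf mY.
apply: (measurability _ (RGenOInfty.measurableE R)) => // _ [_ [x ->] <-].
rewrite setTI comp_preimage -[X in measurable X]setTI; apply: (mY measurableT).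
by apply: sub_sigma_algebra; apply: cf; exact: interval_open.
Qed.

End borel.

Section covariance.
Context {R : realType} {H : completeNormedModType R} (ip : {dot H for idfun}).
Hypothesis ip_norm : hilbert_norm ip.
Context {disp : measure_display} {Omega : measurableType disp} (P : probability Omega R).

Lemma measurable_ip (Y : Omega -> H) x :
  borel_measurable Y -> measurable_fun setT (fun w => ip (Y w) x).
Proof.
by move=> mY; apply: (borel_measurable_real (f := ip^~ x)) => //; exact: continuous_ip.
Qed.

Lemma measurable_norm_sqr (Y : Omega -> H) :
  borel_measurable Y -> measurable_fun setT (fun w => `|Y w| ^+ 2).
Proof.
move=> mY; apply: measurable_funX; apply: (borel_measurable_real (f := fun v => `|v|)) => //.
exact: norm_continuous.
Qed.

Lemma covarianceE (X : Omega -> H) (S : H -> H) v x : is_covariance ip P X S ->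
  ('E_P[fun w => (ip (X w) v * ip (X w) x)%R] = (ip (S v) x)%:E)%E.
Proof.
move=> /(_ v x)[_ <-]; congr expectation; apply/funext => w.
by rewrite /tens ipZl.
Qed.

Lemma covariance_self_adjoint (X : Omega -> H) (S : H -> H) :
  is_covariance ip P X S -> self_adjoint ip S.
Proof.
move=> cS v x; apply: EFin_inj; rewrite -(covarianceE _ _ cS) ipC -(covarianceE _ _ cS).
by congr expectation; apply/funext => w; rewrite mulrC.
Qed.

Lemma covariance_conj (X : Omega -> H) (S A : H -> H) :
  self_adjoint ip A -> is_covariance ip P X S -> is_covariance ip P (A \o X) (A \o S \o A).
Proof.
move=> sA cS v x; have [i1 i2] := cS (A v) (A x).
rewrite /tens/= sA -i2 (_ : (fun w => _) = (fun w => ip (tens ip (X w) (X w) (A v)) (A x)))//.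
by apply/funext => w; rewrite /tens/= !ipZl !sA.
Qed.

Section sample.
Context (n : nat) (Xs : 'I_n -> Omega -> H) (w : Omega).

Lemma sample_covariance_ip v x :
  ip (sample_covariance ip Xs w v) x =
  n%:R^-1 * \sum_(i < n) ip (Xs i w) v * ip (Xs i w) x.
Proof.
by rewrite ipZl ip_suml; congr (_ * _); apply: eq_bigr => i _; rewrite ipZl.
Qed.

Lemma sample_covariance_self_adjoint : self_adjoint ip (sample_covariance ip Xs w).
Proof.
move=> v x; rewrite [RHS]ipC !sample_covariance_ip; congr (_ * _).
by apply: eq_bigr => i _; rewrite mulrC.
Qed.

Lemma sample_covariance_bounded : bounded_op (sample_covariance ip Xs w).
Proof.
exists (n%:R^-1 * \sum_(i < n) `|Xs i w| ^+ 2).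
  by rewrite mulr_ge0// sumr_ge0.
move=> v; rewrite /sample_covariance normrZ ger0_norm// -mulrA ler_wpM2l//.
apply: le_trans (ler_norm_sum _ _ _) _; rewrite mulr_suml; apply: ler_sum => i _.
rewrite /tens normrZ expr2 mulrAC ler_wpM2r//.
exact: ip_cauchy_schwarz.
Qed.

End sample.

Lemma sample_covariance_conj (n : nat) (Xs : 'I_n -> Omega -> H) w (A : H -> H) :
  self_adjoint ip A ->
  sample_covariance ip (fun i => A \o Xs i) w = A \o sample_covariance ip Xs w \o A.
Proof.
move=> sA; apply/funext => v; apply: (ip_inj ip_norm) => x.
rewrite /= sample_covariance_ip sA sample_covariance_ip; congr (_ * _).
by apply: eq_bigr => i _ /=; rewrite !sA.
Qed.

Lemma measurable_sample_covariance_ip (n : nat) (Xs : 'I_n -> Omega -> H) v x :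
  (forall i, borel_measurable (Xs i)) ->
  measurable_fun setT (fun w => ip (sample_covariance ip Xs w v) x).
Proof.
move=> mXs; under eq_fun do rewrite sample_covariance_ip.
apply: measurable_funM; first exact: measurable_cst.
by apply: measurable_sum => i; apply: measurable_funM; exact: measurable_ip.
Qed.

(** The squared norm is the pointwise limit of Parseval sums, so measurable coordinates are
    enough. *)
Lemma measurable_norm_ip p e (Y : Omega -> H) : orthonormal_basis ip p e ->
  (forall x, measurable_fun setT (fun w => ip (Y w) x)) ->
  measurable_fun setT (fun w => `|Y w| ^+ 2).
Proof.
move=> e_basis mY.
apply: (measurable_fun_cvg (h := fun N w => \sum_(j < N | in_dim p j) ip (Y w) (e j) ^+ 2)).
  move=> N; under eq_fun do rewrite big_mkcond.
  apply: measurable_sum => j; case: (in_dim p j); last exact: measurable_cst.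
  exact: measurable_funX.
by move=> w _; exact: parseval2.
Qed.

Lemma independent_copies_comp (X : Omega -> H) (n : nat) (Xs : 'I_n -> Omega -> H) (A : H -> H) :
  continuous A -> independent_copies P X Xs ->
  independent_copies P (A \o X) (fun i => A \o Xs i).
Proof.
move=> cA [mXs dXs iXs]; split=> [i|i B bB|B bB].
- exact: borel_measurable_comp.
- exact: (dXs i _ (borel_set_preimage cA bB)).
- exact: (iXs _ (fun i => borel_set_preimage cA (bB i))).
Qed.

Lemma square_integrable_comp (X : Omega -> H) (A : H -> H) : continuous A -> bounded_op A ->
  borel_measurable X -> square_integrable P X -> square_integrable P (A \o X).
Proof.
move=> cA [M M0 AM] mX X2; rewrite /square_integrable.
apply: (@le_lt_trans _ _ ((M ^+ 2)%:E * 'E_P[fun w => (`|X w| ^+ 2)%R])%E).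
  rewrite unlock -ge0_integralZl//=.
  - apply: ge0_le_integral => //=.
    + by apply/measurable_EFinP; apply: measurable_norm_sqr; exact: borel_measurable_comp.
    + apply/measurable_EFinP/measurable_funM; first exact: measurable_cst.
      exact: measurable_norm_sqr.
    + move=> w _; rewrite lee_fin -exprMn.
      by rewrite lerXn2r ?nnegrE ?mulr_ge0//=; exact: AM.
  - by apply/measurable_EFinP; exact: measurable_norm_sqr.
  - by rewrite lee_fin sqr_ge0.
by apply: lte_mul_pinfty => //; rewrite lee_fin sqr_ge0.
Qed.

(** Since [<A X, v> = <X, A v>], every marginal of [A \o X] is a marginal of [X], and the same
    constant works. *)
Lemma sub_gaussian_comp C1 (X : Omega -> H) (A : H -> H) : continuous A -> bounded_op A ->
  self_adjoint ip A -> borel_measurable X ->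
  sub_gaussian ip P C1 X -> sub_gaussian ip P C1 (A \o X).
Proof.
move=> cA bA sA mX [X2 X_sub]; split; first exact: square_integrable_comp.
(* [F] makes the condition a predicate of the marginal, so that both of its occurrences are
   rewritten at once. *)
move=> v; pose F (f : Omega -> R) : Prop :=
  (ereal_sup [set ((Num.sqrt k%:R)^-1)%:E * ('E_P[fun w => (`|f w| ^+ k)%R] `^ (k%:R^-1))
             | k in [set k | (1 <= k)%N]] <=
   C1%:E * ('E_P[fun w => (f w ^+ 2)%R] `^ (2^-1)))%E.
rewrite -/(F (fun w => ip ((A \o X) w) v)).
rewrite (_ : (fun w => _) = (fun w => ip (X w) (A v))); first exact: X_sub.
by apply/funext => w; rewrite /= sA.
Qed.

End covariance.

(** * Concentration of conjugated sample covariances *)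

Section diagonal.
Context {R : realType} {H : completeNormedModType R} (ip : {dot H for idfun}).
Hypothesis ip_norm : hilbert_norm ip.

Lemma partial_sums_cvg (p : option nat) (s : nat -> R) B :
  (forall j, in_dim p j -> 0 <= s j) ->
  (forall N, \sum_(j < N | in_dim p j) s j <= B) ->
  [/\ cvgn (fun N => \sum_(j < N | in_dim p j) s j),
      limn (fun N => \sum_(j < N | in_dim p j) s j) <= B
    & forall M, \sum_(j < M | in_dim p j) s j <=
        limn (fun N => \sum_(j < N | in_dim p j) s j)].
Proof.
move=> s0 sB; have nd : nondecreasing_seq (fun N => \sum_(j < N | in_dim p j) s j).
  apply/nondecreasing_seqP => m.
  rewrite [leRHS]big_mkcond big_ord_recr/= -big_mkcond/=.
  by rewrite lerDl; case: ifP => // /s0.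
have c : cvgn (fun N => \sum_(j < N | in_dim p j) s j).
  by apply: nondecreasing_is_cvgn => //; exists B => _ [N _ <-].
split=> //; first by apply: limr_le => //; exact: nearW.
by move=> M; exact: (nondecreasing_cvgn_le nd c M).
Qed.

Lemma diagonal_bounded p (e : nat -> H) (T : H -> H) (l : nat -> R) b :
  orthonormal_basis ip p e -> self_adjoint ip T -> 0 <= b ->
  (forall k, in_dim p k -> T (e k) = l k *: e k) ->
  (forall k, in_dim p k -> `|l k| <= b) -> bounded_op T.
Proof.
move=> e_basis sT b0 Te lb; exists b => // v.
rewrite -(@ler_pXn2r _ 2)// ?nnegrE ?mulr_ge0// exprMn.
have h1 := parseval2 ip_norm e_basis (T v).
have h2 : b ^+ 2 * (\sum_(j < N | in_dim p j) ip v (e j) ^+ 2) @[N --> \oo]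
    --> b ^+ 2 * `|v| ^+ 2.
  by apply: cvgM; [exact: cvg_cst|exact: parseval2].
refine (ler_cvg_to h1 h2 _); apply: nearW => N /=.
rewrite mulr_sumr; apply: ler_sum => k pk.
rewrite sT Te// ipZr exprMn ler_wpM2r ?sqr_ge0//.
by rewrite -(real_normK (num_real (l k))) lerXn2r ?nnegrE ?lb.
Qed.

(** This is [c Id + sum_(j < d) beta_j P_j]. It covers both the tail projection and the inverse
    square root of [Sigma] on the leading eigenspace, with finite sums only. *)
Definition diag_op (u : nat -> H) (d : nat) (c : R) (beta : nat -> R) (v : H) : H :=
  c *: v + \sum_(j < d) (beta j * ip v (u j)) *: u j.

Lemma diag_op_self_adjoint u d c beta : self_adjoint ip (diag_op u d c beta).
Proof.
move=> v w; rewrite /diag_op ipDl ipDr ipZl ipZr ip_suml ip_sumr; congr (_ + _).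
by apply: eq_bigr => j _; rewrite ipZl ipZr (ipC ip (u j)); ring.
Qed.

Lemma diag_op_bounded u d c beta : bounded_op (diag_op u d c beta).
Proof.
exists (`|c| + \sum_(j < d) `|beta j| * `|u j| ^+ 2).
  by rewrite addr_ge0// sumr_ge0// => j _; rewrite mulr_ge0.
move=> v; rewrite mulrDl; apply: le_trans (ler_normD _ _) _.
rewrite normrZ lerD2l mulr_suml; apply: le_trans (ler_norm_sum _ _ _) _.
apply: ler_sum => j _; rewrite normrZ normrM.
apply: (@le_trans _ _ (`|beta j| * (`|v| * `|u j|) * `|u j|)); last first.
  by rewrite le_eqVlt; apply/orP; left; apply/eqP; ring.
by rewrite ler_wpM2r// ler_wpM2l// ip_cauchy_schwarz.
Qed.

Lemma diag_op_basis p u d c beta k : orthonormal_basis ip p u ->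
  (forall j, (j < d)%N -> in_dim p j) -> in_dim p k ->
  diag_op u d c beta (u k) = (c + if (k < d)%N then beta k else 0) *: u k.
Proof.
move=> u_basis pd pk; apply: (ip_inj ip_norm) => x.
rewrite /diag_op ipDl ip_suml !ipZl mulrDl; congr (_ + _).
case: ifPn => [kd|kd].
  rewrite (bigD1 (Ordinal kd))//= big1 ?addr0.
    by rewrite ipZl (basis_norm2 u_basis)// mulr1.
  move=> i ik; rewrite ipZl (u_basis.1 k i pk (pd _ (ltn_ord i))).
  suff /negbTE -> : k != i by rewrite mulr0 mul0r.
  by apply: contra ik => /eqP ki; apply/eqP/val_inj.
rewrite mul0r big1// => i _; rewrite ipZl (u_basis.1 k i pk (pd _ (ltn_ord i))).
suff /negbTE -> : k != i by rewrite mulr0 mul0r.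
by apply: contra kd => /eqP ->.
Qed.

(** If [T v = b v], then [(l k - b) <v, e_k> = 0] for all [k]; for [b > l m] every coordinate of [v]
    vanishes. *)
Lemma diagonal_largest_eigenvalue p (e : nat -> H) (T : H -> H) (l : nat -> R) m :
  orthonormal_basis ip p e -> self_adjoint ip T ->
  (forall k, in_dim p k -> T (e k) = l k *: e k) ->
  in_dim p m -> (forall k, in_dim p k -> l k <= l m) -> largest_eigenvalue T (l m).
Proof.
move=> e_basis sT Te pm lm; split.
  exists (e m); last exact: Te.
  by rewrite -normr_eq0 -sqrf_eq0 -ip_norm (basis_norm2 e_basis pm) oner_eq0.
move=> b [v v0 Tv]; rewrite leNgt; apply/negP => mb.
move/eqP : v0; apply; apply: (basis_ext ip_norm e_basis) => k pk.
have : ip (T v) (e k) = b * ip v (e k) by rewrite Tv ipZl.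
rewrite sT Te// ipZr ip0l => /eqP; rewrite -subr_eq0 -mulrBl mulf_eq0 => /orP[|/eqP//].
by rewrite subr_eq0 lt_eqF// (le_lt_trans (lm _ pk)).
Qed.

End diagonal.

(** * Two elementary inequalities for the exponential *)

Lemma expRN_le_inv {R : realType} (y : R) : 0 < y -> expR (- y) <= y^-1.
Proof.
move=> y0; rewrite expRN lef_pV2 ?posrE ?expR_gt0//.
by apply: le_trans (expR_ge1Dx y); rewrite lerDr.
Qed.

(** Squaring [exp(x/2) >= 1 + x/2] reduces the claim to [(1 - x/2)^2 >= 0]. *)
Lemma expR_ge_double {R : realType} (x : R) : 0 <= x -> 2 * x <= expR x.
Proof.
move=> x0; have -> : expR x = expR (x / 2) ^+ 2 by rewrite -expRM_natl; congr expR; field.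
have h := expR_ge1Dx (x / 2).
apply: (@le_trans _ _ ((1 + x / 2) ^+ 2)); last first.
  by rewrite lerXn2r ?nnegrE ?expR_ge0//; lra.
have : 0 <= (1 - x / 2) ^+ 2 by exact: sqr_ge0.
rewrite !expr2; lra.
Qed.

Section deviation.
Context {R : realType} {H : completeNormedModType R} (ip : {dot H for idfun})
  (p : option nat) {disp : measure_display} {Omega : measurableType disp}
  (P : probability Omega R) (X : Omega -> H) (Sigma : H -> H)
  (lam : nat -> R) (u : nat -> H) (n : nat) (Xs : 'I_n -> Omega -> H) (C1 C3 : R).
Hypothesis ip_norm : hilbert_norm ip.
Hypothesis X_meas : borel_measurable X.
Hypothesis X_centered : is_mean ip P X 0.
Hypothesis Sigma_cov : is_covariance ip P X Sigma.
Hypothesis Sigma_spec : spectral_decomposition ip p Sigma lam u.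
Hypothesis lam_gt0 : forall j, in_dim p j -> 0 < lam j.
Hypothesis dim_gt0 : in_dim p 0.
Hypothesis n_ge1 : (1 <= n)%N.
Hypothesis Xs_copies : independent_copies P X Xs.
Hypothesis C3_gt1 : 1 < C3.
Hypothesis C3_def : koltchinskii_lounici C1 C3.
Hypothesis X_subG : sub_gaussian ip P C1 X.

Let Delta w := Sigma \- sample_covariance ip Xs w.

Let u_basis : orthonormal_basis ip p u. Proof. by case: Sigma_spec. Qed.
Let Sigma_sa : self_adjoint ip Sigma. Proof. exact: covariance_self_adjoint Sigma_cov. Qed.

Lemma deviation_self_adjoint w : self_adjoint ip (Delta w).
Proof.
apply: self_adjoint_sub => //; exact: sample_covariance_self_adjoint.
Qed.

Lemma deviation_bounded w : bounded_op (Delta w).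
Proof.
apply: bounded_op_sub; last exact: sample_covariance_bounded.
case: Sigma_spec => _ Su lam_le.
apply: (diagonal_bounded (b := lam 0) ip_norm u_basis Sigma_sa (ltW (lam_gt0 dim_gt0)) Su).
by move=> k pk; rewrite gtr0_norm ?lam_gt0 ?lam_le.
Qed.

Lemma measurable_deviation_ip v x : measurable_fun setT (fun w => ip (Delta w v) x).
Proof.
rewrite (_ : (fun w => _) =
    (fun w => ip (Sigma v) x - ip (sample_covariance ip Xs w v) x)); last first.
  by apply/funext => w; rewrite -ipBl.
apply: measurable_funB; first exact: measurable_cst.
by apply: measurable_sample_covariance_ip; case: Xs_copies.
Qed.

Lemma measurable_deviation_norm_sqr v : measurable_fun setT (fun w => `|Delta w v| ^+ 2).
Proof.
apply: (measurable_norm_ip ip_norm u_basis) => x; exact: measurable_deviation_ip.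
Qed.

Section conjugation.
Variables (A : H -> H) (alpha : nat -> R) (m : nat).
Hypothesis A_sa : self_adjoint ip A.
Hypothesis A_bounded : bounded_op A.
Hypothesis A_diag : forall k, in_dim p k -> A (u k) = alpha k *: u k.
Hypothesis m_dim : in_dim p m.

(** The eigenvalues of [A \o Sigma \o A]. Their order may differ from that of [lam], so the index
    [m] of the largest one is a parameter. *)
Let s k := alpha k ^+ 2 * lam k.
Hypothesis s_max : forall k, in_dim p k -> s k <= s m.
Hypothesis s_gt0 : 0 < s m.

Let s_ge0 k : in_dim p k -> 0 <= s k.
Proof. by move=> pk; rewrite mulr_ge0 ?sqr_ge0// ltW// lam_gt0. Qed.

Let A_cont : continuous A. Proof. exact: (bounded_op_continuous ip_norm). Qed.

Lemma measurable_conj_deviation c : 0 <= c ->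
  measurable [set w | c < op_norm (A \o Delta w \o A)].
Proof.
move=> c0; apply: (measurable_op_norm_gt ip_norm _ _ _ u_basis c0).
- by move=> w; apply: self_adjoint_conj => //; exact: deviation_self_adjoint.
- move=> w; apply: bounded_op_comp => //; apply: bounded_op_comp => //.
  exact: deviation_bounded.
- move=> v; rewrite (_ : (fun w => _) = (fun w => Num.sqrt (`|A (Delta w (A v))| ^+ 2))).
    apply: (measurableT_comp (measurable_funTS (continuous_measurable_fun (@sqrt_continuous R)))).
    apply: (measurable_norm_ip ip_norm u_basis) => x.
    rewrite (_ : (fun w => _) = (fun w => ip (Delta w (A v)) (A x))).
      exact: measurable_deviation_ip.
    by apply/funext => w; rewrite A_sa.
  by apply/funext => w; rewrite sqrtr_sqr normr_id.
Qed.

Lemma conj_basis k : in_dim p k -> (A \o Sigma \o A) (u k) = s k *: u k.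
Proof.
move=> pk; case: Sigma_spec => _ Su _.
rewrite /= A_diag// (self_adjointZ ip_norm Sigma_sa) Su//.
by rewrite !(self_adjointZ ip_norm A_sa) A_diag// !scalerA /s; congr (_ *: _); ring.
Qed.

(** The vector [A \o X] is again centered and sub-Gaussian with constant [C1]. Its covariance and
    sample covariance are those of [X] conjugated by [A], so the Koltchinskii-Lounici inequality
    applies to it. *)
Lemma conj_deviation_exp B x : 0 < x ->
  (forall N, \sum_(k < N | in_dim p k) s k <= B) ->
  B <= n%:R * s m * Num.min x (x ^+ 2) ->
  (P [set w | C3 * s m * x < op_norm (A \o Delta w \o A)]%R
   <= (expR (- (n%:R * Num.min x (x ^+ 2))))%:E)%E.
Proof.
move=> x0 sB Bx.
have sT : self_adjoint ip (A \o Sigma \o A) by exact: self_adjoint_conj.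
have trB : trace ip p u (A \o Sigma \o A) <= B.
  rewrite /trace (_ : (fun N => _) = (fun N => \sum_(k < N | in_dim p k) s k)).
    by have [] := partial_sums_cvg s_ge0 sB.
  apply/funext => N; apply: eq_bigr => k pk.
  by rewrite conj_basis// ipZl (basis_norm2 u_basis)// mulr1.
have AX_centered : is_mean ip P (A \o X) 0.
  move=> v; rewrite (_ : (fun w => ip ((A \o X) w) v) = (fun w => ip (X w) (A v))).
    by rewrite ip0l -(ip0l ip (A v)); exact: X_centered.
  by apply/funext => w; rewrite /= A_sa.
have KL : (P [set w | C3 * s m * x < op_norm ((A \o Sigma \o A) \-
      sample_covariance ip (fun i => A \o Xs i) w)]%R
    <= (expR (- (n%:R * Num.min x (x ^+ 2))))%:E)%E.
  apply: (@C3_def H ip p u disp Omega P (A \o X)) => //.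
  - exact: borel_measurable_comp.
  - exact: sub_gaussian_comp.
  - exact: covariance_conj.
  - exact: (diagonal_largest_eigenvalue ip_norm u_basis sT conj_basis).
  - exact: independent_copies_comp.
  - exact: le_trans Bx.
apply: le_trans KL; rewrite le_eqVlt; apply/orP; left; apply/eqP.
congr (P _); apply/funext => w /=; congr (is_true (_ < op_norm _)); apply/funext => v.
by rewrite (sample_covariance_conj ip_norm)//= (self_adjointB ip_norm A_sa).
Qed.

(* When the trace condition of [koltchinskii_lounici] fails, the right-hand side
   exceeds 1; otherwise use [exp(-y) <= 1/y]. *)
Lemma conj_deviation_le B t (x := t / (C3 * s m)) : 0 < t ->
  (forall N, \sum_(k < N | in_dim p k) s k <= B) ->
  (P [set w | t < op_norm (A \o Delta w \o A)]%R
   <= (B / (n%:R * s m * Num.min x (x ^+ 2)))%:E)%E.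
Proof.
move=> t0 sB.
have x0 : 0 < x by rewrite divr_gt0// mulr_gt0// (lt_trans ltr01).
have y0 : 0 < Num.min x (x ^+ 2) by rewrite lt_min x0 exprn_gt0.
have n0 : 0 < n%:R :> R by rewrite ltr0n.
have nsy0 : 0 < n%:R * s m * Num.min x (x ^+ 2).
  by apply: mulr_gt0 => //; exact: mulr_gt0.
have tE : t = C3 * s m * x.
  by rewrite /x mulrC divfK// gt_eqF// mulr_gt0// (lt_trans ltr01).
have [Bx|Bx] := leP B (n%:R * s m * Num.min x (x ^+ 2)).
  rewrite tE; apply: le_trans (conj_deviation_exp x0 sB Bx) _.
  rewrite lee_fin; apply: le_trans (expRN_le_inv _) _; first exact: mulr_gt0.
  rewrite ler_pdivlMr//.
  have -> : (n%:R * Num.min x (x ^+ 2))^-1 * (n%:R * s m * Num.min x (x ^+ 2)) = s m.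
    by rewrite (mulrAC n%:R) mulKf// gt_eqF//; exact: mulr_gt0.
  (* It remains that [s m <= B], and [s m] is one term of a partial sum bounded by [B]. *)
  apply: le_trans (sB m.+1); rewrite (bigD1 ord_max)//= lerDl sumr_ge0// => k /andP[pk _].
  exact: s_ge0.
apply: (@le_trans _ _ 1%E).
  by apply: probability_le1; exact: measurable_conj_deviation (ltW t0).
by rewrite lee_fin ler_pdivlMr// mul1r ltW.
Qed.

End conjugation.

End deviation.

(** * Expectations *)

Lemma expectationE {R : realType} {disp : measure_display} {Omega : measurableType disp}
  (P : probability Omega R) (f : Omega -> R) :
  ('E_P[f] = \int[P]_w (f w)%:E)%E.
Proof. by rewrite unlock. Qed.

Section expectation_bounds.
Context {R : realType} {disp : measure_display} {Omega : measurableType disp}.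
Variable P : probability Omega R.
Implicit Types (f g : Omega -> R) (a b c : R).

(** Measurability and nonnegativity are bundled with the bound because adding, scaling and summing
    such estimates call for them each time. *)
Definition expectation_le f c : Prop :=
  [/\ measurable_fun setT f, forall w, 0 <= f w & (\int[P]_w (f w)%:E <= c%:E)%E].

Lemma expectation_le_trans f c b : expectation_le f c -> c <= b -> expectation_le f b.
Proof. by move=> [mf f0 fc] cb; split=> //; apply: le_trans fc _; rewrite lee_fin. Qed.

Lemma expectation_leD f g a b : expectation_le f a -> expectation_le g b ->
  expectation_le (fun w => f w + g w) (a + b).
Proof.
move=> [mf f0 fa] [mg g0 gb]; split.
- exact: measurable_funD.
- by move=> w; rewrite addr_ge0.
under eq_integral do rewrite EFinD.
rewrite ge0_integralD//=.
- by rewrite EFinD leeD.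
- by move=> w _; rewrite lee_fin.
- exact/measurable_EFinP.
- by move=> w _; rewrite lee_fin.
- exact/measurable_EFinP.
Qed.

Lemma expectation_leZ f a c : 0 <= a -> expectation_le f c ->
  expectation_le (fun w => a * f w) (a * c).
Proof.
move=> a0 [mf f0 fc]; split.
- by apply: measurable_funM => //; exact: measurable_cst.
- by move=> w; rewrite mulr_ge0.
under eq_integral do rewrite EFinM.
rewrite ge0_integralZl//=.
- by rewrite EFinM lee_wpmul2l.
- exact/measurable_EFinP.
- by move=> w _; rewrite lee_fin.
Qed.

Lemma expectation_le_cst c : 0 <= c -> expectation_le (fun=> c) c.
Proof.
move=> c0; split=> //.
by rewrite integral_cst//= probability_setT mule1.
Qed.

Lemma expectation_le_indic (A : set Omega) c : measurable A -> (P A <= c%:E)%E ->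
  expectation_le \1_A c.
Proof.
move=> mA Ac; split=> [|w|]; first exact: measurable_indic.
- by rewrite indicE.
- by rewrite integral_indic// setIT.
Qed.

Lemma expectation_le_sum (I : Type) (r : seq I) (Q : pred I) (f : I -> Omega -> R) (c : I -> R) :
  (forall i, Q i -> expectation_le (f i) (c i)) ->
  expectation_le (fun w => \sum_(i <- r | Q i) f i w) (\sum_(i <- r | Q i) c i).
Proof.
move=> fc; elim: r => [|i r IH].
  rewrite big_nil (_ : (fun w => _) = (fun=> 0)); first exact: expectation_le_cst.
  by apply/funext => w; rewrite big_nil.
rewrite big_cons (_ : (fun w => _) = (fun w => if Q i then f i w + \sum_(j <- r | Q j) f j w
   else \sum_(j <- r | Q j) f j w)); last by apply/funext => w; rewrite big_cons.
by case: ifPn => // Qi; apply: expectation_leD => //; exact: fc.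
Qed.

Lemma nneseries_le_bound (Q : pred nat) (f : nat -> R) m B :
  (forall k, Q k -> 0 <= f k) -> (forall N, \sum_(m <= k < N | Q k) f k <= B) ->
  (\sum_(m <= k <oo | Q k) (f k)%:E <= B%:E)%E.
Proof.
move=> f0 fB; apply: lime_le.
  by apply: is_cvg_nneseries => k _ Qk; rewrite lee_fin f0.
by apply: nearW => N; rewrite sumEFin lee_fin.
Qed.

Lemma integral_nneseries_le (Q : pred nat) m (f : nat -> Omega -> R) (c : nat -> R) :
  (forall k, (m <= k)%N -> Q k -> expectation_le (f k) (c k)) ->
  measurable_fun setT (fun w => \sum_(m <= k <oo | Q k) (f k w)%:E)%E /\
  (\int[P]_w (\sum_(m <= k <oo | Q k) (f k w)%:E) <= \sum_(m <= k <oo | Q k) (c k)%:E)%E.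
Proof.
(* Exchanging sum and integral asks every term to be measurable and nonnegative; the terms outside
   [Q'], about which nothing is known, are replaced by 0. *)
move=> fc; pose Q' k := Q k && (m <= k)%N.
have fc' k : Q' k -> expectation_le (f k) (c k) by move=> /andP[Qk mk]; exact: fc.
have serE (g : nat -> \bar R) :
    (\sum_(m <= k <oo | Q k) g k = \sum_(0 <= k <oo) if Q' k then g k else 0)%E.
  by rewrite eseries_cond eseries_mkcond.
have mf k : measurable_fun setT (fun w => if Q' k then (f k w)%:E else 0%E).
  have := fc' k; case: (Q' k) => [/(_ isT)[mf _ _]|_]; last exact: measurable_cst.
  exact/measurable_EFinP.
have f0 k w : (0 <= if Q' k then (f k w)%:E else 0)%E.
  by have := fc' k; case: (Q' k) => [/(_ isT)[_ f0 _]|//]; rewrite lee_fin.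
have -> : (fun w => \sum_(m <= k <oo | Q k) (f k w)%:E)%E =
    (fun w => \sum_(0 <= k <oo) if Q' k then (f k w)%:E else 0)%E.
  by apply/funext => w; exact: serE.
rewrite (serE (fun k => (c k)%:E)) integral_nneseries//; split.
  exact: (ge0_emeasurable_sum (P := xpredT)).
apply: lee_nneseries => k _; first by move=> _; apply: integral_ge0 => w _.
have := fc' k; case: (Q' k) => [/(_ isT)[_ _]//|_].
by rewrite integral0.
Qed.

End expectation_bounds.

(** * The excess risk *)

Lemma last_eigenvalue_le {R : realType} (p : option nat) (lam : nat -> R) k :
  (forall i j, (i <= j)%N -> in_dim p j -> lam j <= lam i) ->
  (forall j, in_dim p j -> 0 < lam j) -> in_dim p k -> last_eigenvalue p lam <= lam k.
Proof.
case: p => [m|] lam_le lam_gt0 pk; last exact: ltW (lam_gt0 k pk).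
by case: m lam_le lam_gt0 pk => // m lam_le _ km; apply: lam_le => /=; [exact: km|exact: ltnSn].
Qed.

Section pca.
Context {R : realType} {H : completeNormedModType R} (ip : {dot H for idfun})
  (p : option nat) {disp : measure_display} {Omega : measurableType disp}
  (P : probability Omega R) (X : Omega -> H) (Sigma : H -> H)
  (lam : nat -> R) (u : nat -> H) (n : nat) (Xs : 'I_n -> Omega -> H)
  (hlam : Omega -> nat -> R) (hu : Omega -> nat -> H) (d0 : nat) (C1 C3 : R).
Hypothesis ip_norm : hilbert_norm ip.
Hypothesis X_meas : borel_measurable X.
Hypothesis X_sq : square_integrable P X.
Hypothesis X_centered : is_mean ip P X 0.
Hypothesis Sigma_cov : is_covariance ip P X Sigma.
Hypothesis Sigma_spec : spectral_decomposition ip p Sigma lam u.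
Hypothesis lam_gt0 : forall j, in_dim p j -> 0 < lam j.
Hypothesis n_ge1 : (1 <= n)%N.
Hypothesis Xs_copies : independent_copies P X Xs.
Hypothesis hSigma_spec : forall w,
  spectral_decomposition ip p (sample_covariance ip Xs w) (hlam w) (hu w).

(** With indices from 0, [lam d0] is lambda_d and [lam d], called [mu] below, is lambda_{d+1}. *)
Let d := d0.+1.
Hypothesis d_lt_p : in_dim p d.
Hypothesis C3_gt1 : 1 < C3.
Hypothesis C3_def : koltchinskii_lounici C1 C3.
Hypothesis X_subG : sub_gaussian ip P C1 X.

Let Delta w := Sigma \- sample_covariance ip Xs w.
Let tr := trace ip p u Sigma.
Let mu := lam d.

Let u_basis : orthonormal_basis ip p u. Proof. by case: Sigma_spec. Qed.
Let hu_basis w : orthonormal_basis ip p (hu w). Proof. by case: (hSigma_spec w). Qed.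
Let Sigma_sa : self_adjoint ip Sigma. Proof. exact: covariance_self_adjoint Sigma_cov. Qed.
Let hSigma_sa w : self_adjoint ip (sample_covariance ip Xs w).
Proof. exact: sample_covariance_self_adjoint. Qed.
Let dim_lt j : (j < d)%N -> in_dim p j.
Proof. by move=> jd; apply: in_dim_le d_lt_p; exact: ltnW. Qed.
Let dim_gt0 : in_dim p 0. Proof. exact: dim_lt. Qed.
Let lam_le i j : (i <= j)%N -> in_dim p j -> lam j <= lam i.
Proof. by case: Sigma_spec => _ _ h; exact: h. Qed.
Let n_gt0 : 0 < n%:R :> R. Proof. by rewrite ltr0n. Qed.
Let C3_gt0 : 0 < C3. Proof. exact: lt_trans ltr01 C3_gt1. Qed.

(** * Eigenvalue sums and the trace *)

Lemma traceE : tr = limn (fun N => \sum_(j < N | in_dim p j) lam j).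
Proof.
rewrite /tr /trace.
rewrite (_ : (fun N => _) = (fun N => \sum_(j < N | in_dim p j) lam j))//.
apply/funext => N; apply: eq_bigr => j pj.
by case: Sigma_spec => _ Su _; rewrite Su// ipZl (basis_norm2 u_basis)// mulr1.
Qed.

Lemma covariance_diag k : in_dim p k -> ('E_P[fun w => (ip (X w) (u k) ^+ 2)%R] = (lam k)%:E)%E.
Proof.
move=> pk; rewrite (_ : (fun w => _) = (fun w => ip (X w) (u k) * ip (X w) (u k))).
  rewrite (covarianceE _ _ Sigma_cov); case: Sigma_spec => _ Su _.
  by rewrite Su// ipZl (basis_norm2 u_basis)// mulr1.
by apply/funext => w; rewrite expr2.
Qed.

(** As [lam j] is the second moment of [<X, u_j>], Bessel's inequality bounds the partial sums by
    [E |X|^2]. Hence the limit defining [trace] is a true limit and not a default value. *)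
Lemma sum_eigenvalues_le : exists B, forall N, \sum_(j < N | in_dim p j) lam j <= B.
Proof.
exists (fine ('E_P[fun w => (`|X w| ^+ 2)%R])) => N.
have fin2 : ('E_P[fun w => (`|X w| ^+ 2)%R])%E \is a fin_num.
  rewrite ge0_fin_numE//; rewrite unlock; apply: integral_ge0 => w _.
  by rewrite lee_fin sqr_ge0.
rewrite -lee_fin fineK// -sumEFin.
under eq_bigr => j pj do rewrite -covariance_diag//.
under eq_bigr do rewrite expectationE.
rewrite expectationE -big_filter -ge0_integral_sum//=.
- apply: ge0_le_integral => //=.
  + by move=> w _; apply: sume_ge0 => j _; rewrite lee_fin sqr_ge0.
  + apply: emeasurable_sum => j; apply/measurable_EFinP/measurable_funX.
    exact: measurable_ip.
  + by apply/measurable_EFinP; exact: measurable_norm_sqr.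
  + by move=> w _; rewrite big_filter sumEFin lee_fin; exact: bessel.
- by move=> j; apply/measurable_EFinP/measurable_funX; exact: measurable_ip.
- by move=> j w _; rewrite lee_fin sqr_ge0.
Qed.

Lemma sum_eigenvalues_le_trace N : \sum_(j < N | in_dim p j) lam j <= tr.
Proof.
have [B sB] := sum_eigenvalues_le; rewrite traceE.
by have [] := partial_sums_cvg (fun k pk => ltW (lam_gt0 pk)) sB.
Qed.

Lemma eigenvalue_le_trace k : in_dim p k -> lam k <= tr.
Proof.
move=> pk; apply: le_trans (sum_eigenvalues_le_trace k.+1).
rewrite (bigD1 ord_max)//= lerDl sumr_ge0// => j /andP[pj _].
by rewrite ltW// lam_gt0.
Qed.

Lemma trace_gt0 : 0 < tr.
Proof. exact: lt_le_trans (lam_gt0 dim_gt0) (eigenvalue_le_trace dim_gt0). Qed.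

(** The first [d] terms of the trace are each at least [lam d0]. This trades a factor [d] for
    [tr]. *)
Lemma dim_eigenvalue_le_trace : d%:R * lam d0 <= tr.
Proof.
apply: le_trans (sum_eigenvalues_le_trace d).
under eq_bigl => j do rewrite (dim_lt (ltn_ord j)).
rewrite mulr_natl -[X in _ *+ X]card_ord -sumr_const; apply: ler_sum => j _.
by apply: lam_le; [rewrite -ltnS|exact: dim_lt].
Qed.

(* [A1] is the projection P_{>d} and [A2] is Sigma^{-1/2} P_{<=d}. *)
Let A1 := diag_op ip u d 1 (fun=> -1).
Let A2 := diag_op ip u d 0 (fun j => (Num.sqrt (lam j))^-1).
Let T1 w := op_norm (A1 \o Delta w \o A1).
Let T2 w := op_norm (A2 \o Delta w \o A2).

Let A1_sa : self_adjoint ip A1. Proof. exact: diag_op_self_adjoint. Qed.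
Let A2_sa : self_adjoint ip A2. Proof. exact: diag_op_self_adjoint. Qed.
Let A1_bounded : bounded_op A1. Proof. exact: diag_op_bounded. Qed.
Let A2_bounded : bounded_op A2. Proof. exact: diag_op_bounded. Qed.

(** The leading summands 1 and 0 follow the form of [diag_op_basis], of which [A1_diag] and
    [A2_diag] are instances. *)
Let alpha1 k : R := 1 + if (k < d)%N then -1 else 0.
Let alpha2 k : R := 0 + if (k < d)%N then (Num.sqrt (lam k))^-1 else 0.

Let alpha1E k : alpha1 k ^+ 2 * lam k = if (k < d)%N then 0 else lam k.
Proof. by rewrite /alpha1; case: ifP => _; ring. Qed.

Let alpha2E k : in_dim p k -> alpha2 k ^+ 2 * lam k = (k < d)%:R.
Proof.
move=> pk; rewrite /alpha2 add0r; case: ifP => _; last by rewrite expr2 !mul0r.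
have l0 := lam_gt0 pk.
by rewrite exprVn sqr_sqrtr ?ltW// mulVf// gt_eqF.
Qed.

Let A1_diag k : in_dim p k -> A1 (u k) = alpha1 k *: u k.
Proof. exact: diag_op_basis. Qed.

Let A2_diag k : in_dim p k -> A2 (u k) = alpha2 k *: u k.
Proof. exact: diag_op_basis. Qed.

(** * Probabilities of the exceptional events *)

Lemma measurable_tail_event c : 0 <= c -> measurable [set w | c < T1 w].
Proof.
move=> c0; exact: (measurable_conj_deviation ip_norm Sigma_cov Sigma_spec lam_gt0 dim_gt0
  Xs_copies A1_sa A1_bounded c0).
Qed.

Lemma measurable_white_event c : 0 <= c -> measurable [set w | c < T2 w].
Proof.
move=> c0; exact: (measurable_conj_deviation ip_norm Sigma_cov Sigma_spec lam_gt0 dim_gt0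
  Xs_copies A2_sa A2_bounded c0).
Qed.

(** Conjugation by [A1] leaves top eigenvalue [lam d] and trace at most [tr]. With
    [g = lam j - lam d] and [x = g / (2 C3 lam_d)], the claim reduces to
    [g^2 <= 4 C3^2 lam_j lam_d min(x, x^2)]. *)
Lemma tail_event_prob j : (j < d)%N -> lam d < lam j ->
  (P [set w | (lam j - lam d) / 2 < T1 w]%R
   <= (4 * C3 ^+ 2 * lam j * tr / (n%:R * (lam j - lam d) ^+ 2))%:E)%E.
Proof.
move=> jd ldj; have pj := dim_lt jd.
have lj0 := lam_gt0 pj; have ld0 := lam_gt0 d_lt_p.
have s1d : alpha1 d ^+ 2 * lam d = lam d by rewrite alpha1E ltnn.
have t0 : 0 < (lam j - lam d) / 2 by rewrite divr_gt0// subr_gt0.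
have s_max k : in_dim p k -> alpha1 k ^+ 2 * lam k <= alpha1 d ^+ 2 * lam d.
  move=> pk; rewrite s1d alpha1E; case: ltnP => [_|dk]; first exact: ltW.
  exact: lam_le.
have s_gt0 : 0 < alpha1 d ^+ 2 * lam d by rewrite s1d.
have sB N : \sum_(k < N | in_dim p k) (alpha1 k ^+ 2 * lam k) <= tr.
  apply: le_trans (sum_eigenvalues_le_trace N); apply: ler_sum => k pk.
  by rewrite alpha1E; case: ifP => // _; rewrite ltW// lam_gt0.
apply: le_trans (conj_deviation_le ip_norm X_meas X_centered Sigma_cov Sigma_spec lam_gt0
  dim_gt0 n_ge1 Xs_copies C3_gt1 C3_def X_subG A1_sa A1_bounded A1_diag d_lt_p s_max
  s_gt0 t0 sB) _.
rewrite s1d lee_fin.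
have tr0 := trace_gt0.
set g := lam j - lam d in t0 *; have g0 : 0 < g by rewrite subr_gt0.
have gj : g <= lam j by rewrite /g lerBlDr lerDl ltW.
set x := g / 2 / (C3 * lam d); have x0 : 0 < x by rewrite divr_gt0// mulr_gt0.
have -> : 4 * C3 ^+ 2 * lam j * tr / (n%:R * g ^+ 2) =
    tr / n%:R * (4 * C3 ^+ 2 * lam j / g ^+ 2) by field; rewrite !gt_eqF.
rewrite -(mulrA n%:R) invfM [leLHS]mulrA; apply: ler_wpM2l; first by rewrite ltW// divr_gt0.
have y0 : 0 < Num.min x (x ^+ 2) by rewrite lt_min x0 exprn_gt0.
rewrite -[leLHS]mul1r ler_pdivrMr ?mulr_gt0// mulrAC ler_pdivlMr ?exprn_gt0// mul1r.
(* If the minimum is [x], the bound follows from [g <= lam j] and [C3 > 1]; if it is [x^2], from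
   [lam d <= lam j]. *)
rewrite minElt; case: ifP => _.
  rewrite [leRHS](_ : _ = 2 * C3 * lam j * g); last by rewrite /x; field; rewrite !gt_eqF.
  rewrite expr2; apply: ler_wpM2r; first exact: ltW.
  apply: le_trans gj _; rewrite -[leLHS]mul1r.
  by apply: ler_wpM2r; [exact: ltW|move: C3_gt1; lra].
rewrite [leRHS](_ : _ = lam j / lam d * g ^+ 2); last by rewrite /x; field; rewrite !gt_eqF.
by rewrite -[leLHS]mul1r ler_wpM2r ?sqr_ge0// ler_pdivlMr// mul1r ltW.
Qed.

Let s20 : alpha2 0 ^+ 2 * lam 0 = 1. Proof. by rewrite alpha2E. Qed.

Let s2_max k : in_dim p k -> alpha2 k ^+ 2 * lam k <= alpha2 0 ^+ 2 * lam 0.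
Proof. by move=> pk; rewrite s20 alpha2E//; case: (_ < _)%N. Qed.

Let s2_gt0 : 0 < alpha2 0 ^+ 2 * lam 0. Proof. by rewrite s20. Qed.

Let s2_sum N : \sum_(k < N | in_dim p k) (alpha2 k ^+ 2 * lam k) <= d%:R.
Proof.
under eq_bigr => k pk do rewrite alpha2E//.
rewrite -natr_sum ler_nat big_mkcond.
apply: (@leq_trans (\sum_(k < N) (k < d))); first by apply: leq_sum => k _; case: ifP.
suff -> : (\sum_(k < N) (k < d) = minn N d)%N by exact: geq_minr.
elim: N => [|N IH]; first by rewrite big_ord0 min0n.
by rewrite big_ord_recr/= IH; lia.
Qed.

(** After whitening the trace is at most [d] and the top eigenvalue is 1; here [x <= 1], so the
    minimum is [x^2]. This gives [4 C3^2 d lam_{d0}^2 / (n g^2)], in which [d lam_{d0} <= tr] and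
    the other [lam_{d0}] is below [2 lam_k]. *)
Lemma white_event_prob k : in_dim p k -> (d <= k)%N -> lam k < lam d0 -> lam d0 < 2 * lam k ->
  (P [set w | (lam d0 - lam k) / (2 * lam d0) < T2 w]%R
   <= (8 * C3 ^+ 2 * lam k * tr / (n%:R * (lam d0 - lam k) ^+ 2))%:E)%E.
Proof.
move=> pk dk lkd ld2; have pd0 : in_dim p d0 by exact: dim_lt.
have lk0 := lam_gt0 pk; have ld0 := lam_gt0 pd0.
set g := lam d0 - lam k; have g0 : 0 < g by rewrite subr_gt0.
have t0 : 0 < g / (2 * lam d0) by rewrite divr_gt0// mulr_gt0.
apply: le_trans (conj_deviation_le ip_norm X_meas X_centered Sigma_cov Sigma_spec lam_gt0
  dim_gt0 n_ge1 Xs_copies C3_gt1 C3_def X_subG A2_sa A2_bounded A2_diag dim_gt0 s2_max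
  s2_gt0 t0 s2_sum) _.
rewrite s20 lee_fin !mulr1.
set x := g / _ / C3; have x0 : 0 < x by rewrite divr_gt0.
have x1 : x <= 1.
  rewrite /x ler_pdivrMr// mul1r; apply: le_trans (ltW C3_gt1).
  by rewrite ler_pdivrMr ?mulr_gt0// mul1r /g; lra.
have -> : Num.min x (x ^+ 2) = x ^+ 2 by apply/min_idPr; rewrite expr2 ler_piMl// ltW.
have -> : d%:R / (n%:R * x ^+ 2) = (4 * C3 ^+ 2 * lam d0) * (d%:R * lam d0) / (n%:R * g ^+ 2).
  by rewrite /x; field; rewrite !gt_eqF.
apply: ler_wpM2r; first by rewrite invr_ge0 mulr_ge0 ?sqr_ge0// ltW.
apply: ler_pM; last exact: dim_eigenvalue_le_trace.
- by rewrite !mulr_ge0 ?sqr_ge0// ltW.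
- by rewrite mulr_ge0// ltW.
- have : 0 <= C3 ^+ 2 by exact: sqr_ge0.
  by nra.
Qed.

(** The choice [x = 1 / (4 C3)] turns the threshold into [1/4] and [n x^2] into [n / (16 C3^2)]; the
    trace condition becomes the assumed bound on [d]. *)
Lemma white_event_prob_quarter : d%:R <= n%:R / (16 * C3 ^+ 2) ->
  (P [set w | 4^-1 < T2 w]%R <= (expR (- (n%:R / (16 * C3 ^+ 2))))%:E)%E.
Proof.
move=> dn; pose x := (4 * C3)^-1.
have x0 : 0 < x by rewrite invr_gt0 mulr_gt0.
have x1 : x <= 1.
  rewrite invf_le1 ?mulr_gt0//; move: C3_gt1; lra.
have xE : Num.min x (x ^+ 2) = x ^+ 2 by apply/min_idPr; rewrite expr2 ler_piMl// ltW.
have nE : n%:R * x ^+ 2 = n%:R / (16 * C3 ^+ 2) by rewrite /x; field; rewrite !gt_eqF.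
have tE : 4^-1 = C3 * (alpha2 0 ^+ 2 * lam 0) * x.
  by rewrite s20 mulr1 /x; field; rewrite !gt_eqF.
rewrite -nE -xE tE.
apply: (conj_deviation_exp ip_norm X_meas X_centered Sigma_cov Sigma_spec lam_gt0
  n_ge1 Xs_copies C3_def X_subG A2_sa A2_bounded A2_diag dim_gt0 s2_max x0 s2_sum).
by rewrite s20 mulr1 xE nE.
Qed.

(** * Sample eigenvalues by min-max *)

Lemma deviation_quad w v : ip (sample_covariance ip Xs w v) v = ip (Sigma v) v - ip (Delta w v) v.
Proof. by rewrite /Delta/= ipBl; ring. Qed.

Let Delta_sa w : self_adjoint ip (Delta w).
Proof. exact: (deviation_self_adjoint Xs Sigma_cov). Qed.
Let Delta_bounded w : bounded_op (Delta w).
Proof. exact: (deviation_bounded Xs ip_norm Sigma_cov Sigma_spec lam_gt0 dim_gt0). Qed.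

Lemma conj_deviation_quad A w v : self_adjoint ip A -> bounded_op A ->
  `|ip (Delta w (A v)) (A v)| <= op_norm (A \o Delta w \o A) * `|v| ^+ 2.
Proof.
move=> sA bA; rewrite -sA; apply: (op_norm_quad ip_norm).
  exact: self_adjoint_conj.
by apply: bounded_op_comp => //; apply: bounded_op_comp.
Qed.

(** A vector orthogonal to the first [d] eigenvectors of [Sigma] is fixed by [A1], so only the
    conjugated deviation acts on it. *)
Lemma sample_eigenvalue_le w t : T1 w <= t -> hlam w d <= lam d + t.
Proof.
move=> T1t; apply: (eigenvalue_le ip_norm (hSigma_spec w) (hSigma_sa w) (f := u)) => // v vu.
have Av : A1 v = v.
  rewrite /A1 /diag_op scale1r big1 ?addr0// => j _.
  by rewrite vu ?ltn_ord// mulr0 scale0r.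
have h1 := conj_deviation_quad w v A1_sa A1_bounded.
rewrite Av -/(T1 w) in h1.
have h2 : ip (Sigma v) v <= lam d * `|v| ^+ 2.
  apply: (spectral_quad_le ip_norm Sigma_spec Sigma_sa (m := d)) => [k kd _|k dk pk].
    exact: vu.
  exact: lam_le.
rewrite deviation_quad mulrDl; apply: lerD => //.
apply: le_trans (ler_norm _) _; rewrite normrN; apply: le_trans h1 _.
by rewrite ler_wpM2r.
Qed.

(** On the leading eigenspace [v = A2 y] with [|y|^2 = <Sigma v, v>], so the perturbation is
    relative: [<Delta v, v> <= t <Sigma v, v>]. *)
Lemma le_sample_eigenvalue w t : T2 w <= t -> t <= 1 -> lam d0 * (1 - t) <= hlam w d0.
Proof.
move=> T2t t1; have pd0 : in_dim p d0 by exact: dim_lt.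
apply: (le_eigenvalue ip_norm (hSigma_spec w) (hSigma_sa w) pd0 u_basis) => c /=.
set v := \sum_(_ < _ | _) _.
(* [y] is [Sigma^{1/2} v]. *)
pose y := \sum_(i < d0.+1 | in_dim p i) (Num.sqrt (lam i) * c i) *: u i.
have yu k : (k < d)%N -> ip y (u k) = Num.sqrt (lam k) * c k.
  by move=> kd; rewrite (basis_ip_sum u_basis d (fun k => Num.sqrt (lam k) * c k) (dim_lt kd)) kd.
have Ay : A2 y = v.
  rewrite /A2 /diag_op scale0r add0r /v [RHS](eq_bigl xpredT) => [|i].
    apply: eq_bigr => i _; rewrite yu//; congr (_ *: _).
    by rewrite mulKf// gt_eqF// sqrtr_gt0 lam_gt0// dim_lt.
  by rewrite dim_lt.
have y2 : `|y| ^+ 2 = ip (Sigma v) v.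
  rewrite (basis_norm2_sum ip_norm u_basis d (fun k => Num.sqrt (lam k) * c k)).
  rewrite (spectral_span_quad Sigma_spec Sigma_sa).
  by apply: eq_bigr => i pi; rewrite exprMn sqr_sqrtr// ltW// lam_gt0.
have v2 : lam d0 * `|v| ^+ 2 <= `|y| ^+ 2.
  rewrite y2 (spectral_span_quad Sigma_spec Sigma_sa).
  rewrite (basis_norm2_sum ip_norm u_basis) mulr_sumr; apply: ler_sum => i pi.
  by rewrite ler_wpM2r ?sqr_ge0// lam_le// -ltnS.
have := conj_deviation_quad w y A2_sa A2_bounded.
rewrite Ay deviation_quad -y2 -/(T2 w) => h.
have {}h : ip (Delta w v) v <= t * `|y| ^+ 2.
  apply: le_trans (ler_norm _) _; apply: le_trans h _.
  by rewrite ler_wpM2r.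
have {}v2 : (1 - t) * (lam d0 * `|v| ^+ 2) <= (1 - t) * `|y| ^+ 2.
  by rewrite ler_wpM2l// subr_ge0.
rewrite [_ * (1 - t)]mulrC -mulrA; apply: le_trans v2 _.
by rewrite mulrBl mul1r lerD2l lerN2.
Qed.

(* [a w k] is the squared Hilbert-Schmidt norm of P_k hat P_{<=d}. *)
Let a w k := \sum_(i < d) ip (u k) (hu w i) ^+ 2.

(** * Overlaps of the true and empirical eigenspaces *)

Lemma overlap_ge0 w k : 0 <= a w k.
Proof. by apply: sumr_ge0 => i _; rewrite sqr_ge0. Qed.

Lemma overlapE w k : a w k = \sum_(i < d | in_dim p i) ip (u k) (hu w i) ^+ 2.
Proof. by apply: eq_bigl => i; rewrite dim_lt. Qed.

Lemma overlap_le1 w k : in_dim p k -> a w k <= 1.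
Proof.
move=> pk; rewrite overlapE; apply: le_trans (bessel ip_norm (hu_basis w) (u k) d) _.
by rewrite -ip_norm (basis_norm2 u_basis).
Qed.

Lemma deviation_basis_ip w k i : in_dim p k -> in_dim p i ->
  ip (Delta w (u k)) (hu w i) = (lam k - hlam w i) * ip (u k) (hu w i).
Proof.
move=> pk pi; case: Sigma_spec => _ Su _; case: (hSigma_spec w) => _ hSu _.
by rewrite /Delta/= ipBl Su// hSigma_sa hSu// ipZl ipZr mulrBl.
Qed.

(** By Parseval [1 - a w j] is the sum of [<u_j, hu_i>^2] over [i >= d]. For these [i] the sample
    eigenvalue is at most [lam d + t = lam j - t], so [deviation_basis_ip] gains a factor of at
    least [t^2]. *)
Lemma head_overlap_le w j (t := (lam j - lam d) / 2) : (j < d)%N -> lam d < lam j -> T1 w <= t ->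
  t ^+ 2 * (1 - a w j) <= `|Delta w (u j)| ^+ 2.
Proof.
move=> jd ldj T1t; have pj := dim_lt jd.
have hl i : (d <= i)%N -> in_dim p i -> t ^+ 2 <= (lam j - hlam w i) ^+ 2.
  move=> di pi; have h := sample_eigenvalue_le T1t.
  case: (hSigma_spec w) => _ _ /(_ _ _ di pi) h'.
  have t0 : 0 <= t by rewrite divr_ge0// subr_ge0 ltW.
  have tl : t <= lam j - hlam w i by move: h; rewrite /t; lra.
  by rewrite lerXn2r ?nnegrE// (le_trans t0).
have cv : t ^+ 2 * (\sum_(i < N | in_dim p i) ip (u j) (hu w i) ^+ 2 - a w j) @[N --> \oo]
    --> t ^+ 2 * (1 - a w j).
  apply: cvgM; first exact: cvg_cst.
  apply: cvgB; last exact: cvg_cst.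
  have -> : 1 = `|u j| ^+ 2 by rewrite -ip_norm (basis_norm2 u_basis).
  exact: parseval2.
refine (ler_cvg_to cv (cvg_cst _) _).
exists d => // N /= dN; apply: le_trans (bessel ip_norm (hu_basis w) _ N).
rewrite -(subnKC dN) overlapE big_split_ord/=.
rewrite addrAC subrr add0r [leRHS]big_split_ord/= -[leLHS]add0r mulr_sumr.
apply: lerD; first by apply: sumr_ge0 => i _; rewrite sqr_ge0.
apply: ler_sum => i pi; rewrite deviation_basis_ip// [leRHS]exprMn ler_wpM2r ?sqr_ge0//.
by apply: hl => //; exact: leq_addr.
Qed.

(** The choice of [t] makes [lam d0 * (1 - t)] the midpoint of [lam d0] and [lam k]; the leading
    sample eigenvalues stay above it, at distance at least half the gap from [lam k]. *)
Lemma tail_overlap_le w k (t := (lam d0 - lam k) / (2 * lam d0)) :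
  in_dim p k -> (d <= k)%N -> lam k < lam d0 -> T2 w <= t ->
  ((lam d0 - lam k) / 2) ^+ 2 * a w k <= `|Delta w (u k)| ^+ 2.
Proof.
move=> pk dk lkd T2t; have pd0 : in_dim p d0 by exact: dim_lt.
have ld0 := lam_gt0 pd0; have lk0 := lam_gt0 pk.
have t1 : t <= 1 by rewrite /t ler_pdivrMr ?mulr_gt0//; lra.
have h := le_sample_eigenvalue T2t t1.
have {}h : (lam d0 + lam k) / 2 <= hlam w d0.
  apply: le_trans h; rewrite le_eqVlt; apply/orP; left; apply/eqP.
  by rewrite /t; field; rewrite gt_eqF.
apply: le_trans (bessel ip_norm (hu_basis w) _ d).
rewrite overlapE mulr_sumr; apply: ler_sum => i pi.
rewrite deviation_basis_ip// [leRHS]exprMn ler_wpM2r ?sqr_ge0//.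
case: (hSigma_spec w) => _ _ /(_ i d0 (ltn_ord i) pd0) h'.
rewrite -[leRHS]sqrrN lerXn2r ?nnegrE//; lra.
Qed.

(** * Decomposition of the excess risk *)

Let risk := excess_risk ip p Sigma u hu d.

Lemma risk_term w j : in_dim p j ->
  ip (Sigma (u j)) ((proj_le ip u d \- proj_le ip (hu w) d) (u j)) =
  lam j * ((j < d)%:R - a w j).
Proof.
move=> pj; case: Sigma_spec => _ Su _; rewrite Su// ipZl; congr (_ * _).
rewrite /= ipBr /proj_le /Defs.proj /tens !ip_sumr; congr (_ - _); last first.
  by apply: eq_bigr => i _; rewrite ipZr (ipC ip (hu w i)) expr2.
case: ltnP => [jd|dj].
  rewrite (bigD1 (Ordinal jd))//= ipZr (basis_norm2 u_basis)// mulr1 big1 ?addr0// => i ij.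
  rewrite ipZr (u_basis.1 j i pj (dim_lt (ltn_ord i))).
  suff /negbTE -> : j != i by rewrite mulr0.
  by apply: contra ij => /eqP ij; apply/eqP/val_inj.
apply: big1 => i _; rewrite ipZr (u_basis.1 j i pj (dim_lt (ltn_ord i))).
suff /negbTE -> : j != i by rewrite mulr0.
by rewrite neq_ltn orbC (leq_trans (ltn_ord i)).
Qed.

(** The trace of the empirical projection is [d]: after exchanging sums, each unit vector [hu w i]
    contributes 1 by Parseval. *)
Lemma sum_overlap_cvg w : \sum_(j < N | in_dim p j) a w j @[N --> \oo] --> (d%:R : R).
Proof.
have -> : d%:R = \sum_(i < d) `|hu w i| ^+ 2.
  rewrite -[X in X%:R]card_ord -sumr_const; apply: eq_bigr => i _.
  by rewrite -ip_norm (basis_norm2 (hu_basis w))// dim_lt.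
under eq_fun do rewrite exchange_big/=.
apply: cvg_big => [|i _]; first exact: add_continuous.
under eq_fun do under eq_bigr do rewrite ipC.
exact: parseval2.
Qed.

Lemma sum_overlap_le w N : \sum_(j < N | in_dim p j) a w j <= d%:R.
Proof.
rewrite exchange_big/= -[X in X%:R]card_ord -sumr_const; apply: ler_sum => i _.
apply: le_trans (_ : `|hu w i| ^+ 2 <= _); last first.
  by rewrite -ip_norm (basis_norm2 (hu_basis w))// dim_lt.
by under eq_bigr do rewrite ipC; exact: bessel.
Qed.

Lemma sum_tail_overlap_le w N : \sum_(d <= j < N | in_dim p j) a w j <= d%:R.
Proof.
apply: le_trans (sum_overlap_le w N); rewrite -(big_mkord (in_dim p) (a w)).
have [dN|Nd] := leqP d N; last first.
  rewrite (@big_geq _ _ _ d N _ _ (ltnW Nd)).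
  by apply: sumr_ge0 => j _; exact: overlap_ge0.
rewrite [leRHS](big_cat_nat (n := d) _ dN)//= lerDr.
by apply: sumr_ge0 => j _; exact: overlap_ge0.
Qed.

Let head w := \sum_(j < d) (lam j - mu) * (1 - a w j).
Let tail w N := \sum_(d <= k < N | in_dim p k) (mu - lam k) * a w k.

Let tail_term_ge0 w k : in_dim p k -> (d <= k)%N -> 0 <= (mu - lam k) * a w k.
Proof.
by move=> pk dk; rewrite mulr_ge0 ?overlap_ge0// subr_ge0 lam_le.
Qed.

Lemma head_ge0 w : 0 <= head w.
Proof.
apply: sumr_ge0 => j _; rewrite mulr_ge0// subr_ge0 ?overlap_le1 ?dim_lt//.
by rewrite lam_le// ltnW.
Qed.

Lemma tail_ge0 w N : 0 <= tail w N.
Proof.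
rewrite /tail big_nat_cond; apply: sumr_ge0 => k /andP[/andP[dk _] pk].
exact: tail_term_ge0.
Qed.

Lemma tail_cvg w : cvgn (tail w).
Proof.
apply: nondecreasing_is_cvgn.
  apply/nondecreasing_seqP => N; rewrite /tail.
  have [dN|Nd] := leqP d N; last by rewrite !(@big_geq _ _ _ d) ?(ltnW Nd).
  rewrite [leRHS]big_mkcond big_nat_recr//= -big_mkcond/=.
  by rewrite lerDl; case: ifP => // pN; exact: tail_term_ge0.
exists (mu * d%:R) => _ [N _ <-].
apply: (@le_trans _ _ (\sum_(d <= k < N | in_dim p k) mu * a w k)).
  apply: ler_sum => k pk; rewrite ler_wpM2r ?overlap_ge0//.
  by rewrite gerBl ltW// lam_gt0.
by rewrite -mulr_sumr ler_wpM2l ?sum_tail_overlap_le// ltW// lam_gt0.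
Qed.

Let head_tail_cvg w : head w + tail w N @[N --> \oo] --> head w + limn (tail w).
Proof. by apply: cvgD; [exact: cvg_cst|exact: tail_cvg]. Qed.

(** Subtracting [mu] from every eigenvalue changes the partial sums by [mu] times [d] minus the sum
    of overlaps, which tends to 0. *)
Lemma excess_riskE w : risk w = limn (fun N => head w + tail w N).
Proof.
have cS : head w + tail w N + mu * (d%:R - \sum_(j < N | in_dim p j) a w j) @[N --> \oo]
    --> head w + limn (tail w).
  have -> : head w + limn (tail w) = head w + limn (tail w) + mu * (d%:R - d%:R).
    by rewrite subrr mulr0 addr0.
  apply: cvgD; first exact: head_tail_cvg.
  apply: cvgM; first exact: cvg_cst.
  by apply: cvgB; [exact: cvg_cst|exact: sum_overlap_cvg].
have -> : limn (fun N => head w + tail w N) = head w + limn (tail w).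
  by apply: cvg_lim => //; exact: head_tail_cvg.
apply: cvg_lim => //; refine (cvg_trans _ cS); apply: near_eq_cvg.
exists d => // N /= dN.
under [RHS]eq_bigr => j pj do rewrite risk_term//.
rewrite -(big_mkord _ (a w)) -(big_mkord _ (fun j => lam j * ((j < d)%:R - a w j))).
rewrite !(big_cat_nat (m := 0%N) (n := d) (p := N) _ dN)//=.
have -> : \sum_(d <= j < N | in_dim p j) lam j * ((j < d)%:R - a w j) =
    tail w N - mu * \sum_(d <= j < N | in_dim p j) a w j.
  rewrite /tail mulr_sumr -sumrB big_nat_cond [RHS]big_nat_cond.
  by apply: eq_bigr => j /andP[/andP[dj _] _]; rewrite ltnNge dj/=; ring.
have -> : \sum_(0 <= j < d | in_dim p j) lam j * ((j < d)%:R - a w j) =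
    head w + mu * (d%:R - \sum_(0 <= j < d | in_dim p j) a w j).
  have -> : d%:R = \sum_(0 <= j < d | in_dim p j) (1 : R).
    rewrite big_mkord (eq_bigl xpredT) => [|i]; last by rewrite dim_lt.
    by rewrite sumr_const card_ord.
  have -> : head w = \sum_(0 <= j < d | in_dim p j) (lam j - mu) * (1 - a w j).
    by rewrite big_mkord; apply: eq_bigl => j; rewrite dim_lt.
  rewrite -sumrB mulr_sumr -big_split/= big_nat_cond [RHS]big_nat_cond.
  by apply: eq_bigr => j /andP[/andP[_ jd] _]; rewrite jd/=; ring.
ring.
Qed.

Lemma excess_risk_ge0 w : 0 <= risk w.
Proof.
rewrite excess_riskE; apply: limr_ge.
  by apply/cvg_ex; eexists; exact: head_tail_cvg.
by apply: nearW => N; rewrite addr_ge0 ?head_ge0 ?tail_ge0.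
Qed.

(** A bound uniform in [N] passes to the limit. The series is extended-real because it may diverge
    at a given [w]. *)
Lemma excess_risk_le w h (Q : pred nat) (g : nat -> R) :
  (forall k, (d <= k)%N -> Q k -> 0 <= g k) ->
  (forall N, head w + tail w N <= h + \sum_(d <= k < N | Q k) g k) ->
  ((risk w)%:E <= h%:E + \sum_(d <= k <oo | Q k) (g k)%:E)%E.
Proof.
move=> g0 hg; have c : cvgn (fun N => head w + tail w N).
  by apply/cvg_ex; eexists; exact: head_tail_cvg.
rewrite excess_riskE -EFin_lim//; apply: lime_le.
  apply/cvg_ex; exists (head w + limn (tail w))%:E.
  by apply: cvg_EFin; [exact: nearW|exact: head_tail_cvg].
apply: nearW => N /=; apply: (@le_trans _ _ (h%:E + \sum_(d <= k < N | Q k) (g k)%:E)%E).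
  by rewrite sumEFin lee_fin.
rewrite leeD2l//; apply: nneseries_lim_ge => k dk Qk.
by rewrite lee_fin g0.
Qed.

(** * Moments of the deviation *)

Variable C2 : R.
Hypothesis C2_gt0 : 0 < C2.
Hypothesis C2_bound : fourth_moment_bound ip P p u lam Sigma Xs C2.
Hypothesis risk_meas : measurable_fun setT risk.
Hypothesis d_le : d%:R <= n%:R / (16 * C3 ^+ 2).

Let C := 8 * C2 + 8 * C3 ^+ 2.
Let C_gt0 : 0 < C. Proof. by rewrite addr_gt0// mulr_gt0// exprn_gt0. Qed.

(** [P_j Delta P_k] has a single nonzero matrix entry at most, so the defining sequence is constant
    from [N = k.+1] on. *)
Lemma hs_norm_rank1 w j k : in_dim p j -> in_dim p k ->
  hs_norm ip p u (Defs.proj ip u j \o (Sigma \- sample_covariance ip Xs w) \o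
    Defs.proj ip u k) ^+ 2 =
  ip (Delta w (u k)) (u j) ^+ 2.
Proof.
move=> pj pk; rewrite /hs_norm; set S := hs_dot _ _ _ _ _.
suff -> : S = ip (Delta w (u k)) (u j) ^+ 2 by rewrite sqr_sqrtr ?sqr_ge0.
pose T v := ip (u j) (Delta w (ip (u k) v *: u k)) *: u j.
have -> : S = limn (fun N => \sum_(i < N | in_dim p i) ip (T (u i)) (T (u i))) by [].
apply: lim_near_cst => //; exists k.+1 => // N /= kN.
rewrite (bigD1 (Ordinal kN))//= big1 ?addr0.
  rewrite /T (basis_norm2 u_basis pk) scale1r ipZl ipZr (basis_norm2 u_basis pj).
  by rewrite mulr1 (ipC ip (u j)) expr2.
move=> i /andP[pi ik]; rewrite /T (u_basis.1 k i pk pi).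
suff /negbTE -> : k != i.
  by rewrite scale0r (self_adjoint0 ip_norm (Delta_sa w)) ip0r scale0r ip0l.
by apply: contra ik => /eqP ki; apply/eqP/val_inj.
Qed.

Let mDelta v x : measurable_fun setT (fun w => ip (Delta w v) x).
Proof. exact: (measurable_deviation_ip Sigma ip_norm Xs_copies). Qed.

Let mDelta2 v : measurable_fun setT (fun w => `|Delta w v| ^+ 2).
Proof. exact: (measurable_deviation_norm_sqr ip_norm Sigma_spec Xs_copies). Qed.

(** The factor 2 covers the diagonal and off-diagonal cases alike, which lets the entries be summed
    over [j]. *)
Lemma deviation_entry_expectation j k : in_dim p j -> in_dim p k ->
  expectation_le P (fun w => ip (Delta w (u k)) (u j) ^+ 2) (2 * C2 * lam k * lam j / n%:R).
Proof.
move=> pj pk; split; first exact: measurable_funX.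
  by move=> w; rewrite sqr_ge0.
have := C2_bound pj pk; rewrite expectationE.
under eq_integral do rewrite hs_norm_rank1//.
move/le_trans; apply; rewrite lee_fin ler_wpM2r ?invr_ge0//.
have lj0 := ltW (lam_gt0 pj); have lk0 := ltW (lam_gt0 pk).
rewrite (_ : 2 * C2 * lam k * lam j = C2 * 2 * lam j * lam k); last by ring.
by rewrite !ler_wpM2r// ler_wpM2l ?(ltW C2_gt0)//; case: eqP => _; rewrite ?ler1n.
Qed.

Lemma deviation_norm_expectation k : in_dim p k ->
  expectation_le P (fun w => `|Delta w (u k)| ^+ 2) (2 * C2 * lam k * tr / n%:R).
Proof.
move=> pk; split; first exact: mDelta2.
  by move=> w; rewrite sqr_ge0.
under eq_integral do rewrite -(parseval_series ip_norm u_basis).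
have [_] := @integral_nneseries_le _ _ _ P (in_dim p) 0%N
  (fun j w => ip (Delta w (u k)) (u j) ^+ 2) _
  (fun j _ pj => deviation_entry_expectation pj pk).
move/le_trans; apply.
have c0 : 0 <= 2 * C2 * lam k by rewrite !mulr_ge0 ?ltW ?lam_gt0.
apply: nneseries_le_bound => [j pj|N].
  by rewrite divr_ge0// mulr_ge0// ltW// lam_gt0.
rewrite -mulr_suml ler_wpM2r ?invr_ge0// -mulr_sumr ler_wpM2l//.
by rewrite big_mkord sum_eigenvalues_le_trace.
Qed.

(** Both bounds on the risk are reduced to a pointwise estimate of the finite sums
    [head w + tail w N], integrated term by term. *)
Lemma risk_expectation_le (h : Omega -> R) ch (Q : pred nat) (g : nat -> Omega -> R) cg :
  expectation_le P h ch ->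
  (forall k, (d <= k)%N -> Q k -> expectation_le P (g k) (cg k)) ->
  (forall w N, head w + tail w N <= h w + \sum_(d <= k < N | Q k) g k w) ->
  ('E_P[risk] <= ch%:E + \sum_(d <= k <oo | Q k) (cg k)%:E)%E.
Proof.
move=> [mh h0 hch] gcg hg.
have [mg g_le] := integral_nneseries_le gcg.
have g0 w k : (d <= k)%N -> Q k -> (0 <= (g k w)%:E)%E.
  by move=> dk /(gcg k dk)[_ + _]; rewrite lee_fin.
have G0 w : (0 <= \sum_(d <= k <oo | Q k) (g k w)%:E)%E.
  by apply: nneseries_ge0 => k dk Qk; exact: g0.
apply: (@le_trans _ _ (\int[P]_w ((h w)%:E + \sum_(d <= k <oo | Q k) (g k w)%:E))%E).
  rewrite expectationE; apply: ge0_le_integral => //=.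
  - by move=> w _; rewrite lee_fin excess_risk_ge0.
  - exact/measurable_EFinP.
  - by apply: emeasurable_funD => //; exact/measurable_EFinP.
  - by move=> w _; apply: excess_risk_le => // k dk Qk; rewrite -lee_fin g0.
rewrite ge0_integralD//.
- exact: leeD.
- by move=> w _; rewrite lee_fin.
- exact/measurable_EFinP.
Qed.

(** * Termwise estimates with spectral gaps and the local bound *)

Let B1 j := [set w | (lam j - lam d) / 2 < T1 w].
Let B2 k := [set w | (lam d0 - lam k) / (2 * lam d0) < T2 w].
Let B0 := [set w | 4^-1 < T2 w].

Let mu_gt0 : 0 < mu. Proof. exact: lam_gt0. Qed.
Let d0_dim : in_dim p d0. Proof. exact: dim_lt. Qed.
Let ld0_gt0 : 0 < lam d0. Proof. exact: lam_gt0. Qed.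
Let mu_le : mu <= lam d0. Proof. exact: lam_le. Qed.

(** The first summand bounds the head term off [B1 j]; the second bounds it on [B1 j], where only
    [1 - a w j <= 1] is used. *)
Let hterm j w := 4 / (lam j - lam d) * `|Delta w (u j)| ^+ 2 + (lam j - lam d) * \1_(B1 j) w.

Lemma head_term_le w j : (j < d)%N -> lam d < lam j ->
  (lam j - mu) * (1 - a w j) <= hterm j w.
Proof.
move=> jd ldj; have g0 : 0 < lam j - lam d by rewrite subr_gt0.
have a0 := overlap_ge0 w j.
rewrite /hterm indicE; have [|/negP] := pselect (w \in B1 j).
  move=> -> /=; rewrite mulr1 -[leLHS]add0r; apply: lerD.
    by rewrite mulr_ge0 ?sqr_ge0// ltW// divr_gt0.
  by apply: ler_piMr; [exact: ltW|rewrite gerBl].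
move=> wB; rewrite (negbTE wB) mulr0 addr0.
have T1t : T1 w <= (lam j - lam d) / 2 by rewrite leNgt; apply: contra wB => wB; rewrite inE.
have := head_overlap_le jd ldj T1t.
rewrite -/mu in g0 *; set g := lam j - mu in g0 * => h.
rewrite mulrAC ler_pdivlMr//.
have -> : g * (1 - a w j) * g = 4 * ((g / 2) ^+ 2 * (1 - a w j)) by field.
by rewrite ler_wpM2l.
Qed.

Lemma head_term_expectation j : (j < d)%N -> lam d < lam j ->
  expectation_le P (hterm j) (C * (lam j * tr / (n%:R * (lam j - lam d)))).
Proof.
move=> jd ldj; have pj := dim_lt jd; have lj0 := lam_gt0 pj.
have g0 : 0 < lam j - lam d by rewrite subr_gt0.
have t0 : 0 < (lam j - lam d) / 2 by rewrite divr_gt0.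
apply: expectation_le_trans.
  apply: expectation_leD.
    by apply: expectation_leZ (deviation_norm_expectation pj); rewrite divr_ge0// ltW.
  apply: expectation_leZ; first exact: ltW.
  exact: expectation_le_indic (measurable_tail_event (ltW t0)) (tail_event_prob jd ldj).
(* [8 * C2] is 4 times the [2 * C2] of the moment bound; [4 * C3 ^+ 2] comes from the event
   [B1 j]. *)
rewrite [leLHS](_ : _ = (8 * C2 + 4 * C3 ^+ 2) * (lam j * tr / (n%:R * (lam j - lam d)))).
  rewrite ler_wpM2r//; last by rewrite /C lerD2l ler_wpM2r ?sqr_ge0// ler_nat.
  by rewrite divr_ge0// mulr_ge0 ?(ltW trace_gt0) ?ltW.
by field; rewrite !gt_eqF.
Qed.

Let gap k := lam d0 - lam k.

(** For [2 lam_k > lam_{d0}] the event [B2 k] is kept, as its probability bound carries a factor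
    [lam k]. For smaller [lam k] its threshold is at least [1/4], so [B2 k] lies in the common event
    [B0]. *)
Lemma tail_event_caseP w k : in_dim p k -> (d <= k)%N -> lam k < lam d0 ->
  [\/ (gap k) ^+ 2 * a w k <= 4 * `|Delta w (u k)| ^+ 2,
      lam d0 < 2 * lam k /\ w \in B2 k
    | w \in B0].
Proof.
move=> pk dk lkd; have lk0 := lam_gt0 pk.
have [wB2|/negP wB2] := pselect (w \in B2 k).
  have [h|h] := ltP (lam d0) (2 * lam k); first exact: Or32.
  apply: Or33; move: wB2; rewrite !inE /B2 /B0 /=; apply: le_lt_trans.
  rewrite ler_pdivlMr ?mulr_gt0//.
  lra.
apply: Or31; have T2t : T2 w <= (lam d0 - lam k) / (2 * lam d0).
  by rewrite leNgt; apply: contra wB2 => wB2; rewrite inE.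
have h := tail_overlap_le pk dk lkd T2t.
have -> : gap k ^+ 2 * a w k = 4 * (((lam d0 - lam k) / 2) ^+ 2 * a w k).
  by rewrite /gap; field.
by rewrite ler_wpM2l.
Qed.

Let gterm k w := 4 / gap k * `|Delta w (u k)| ^+ 2 +
  (if lam d0 < 2 * lam k then gap k * \1_(B2 k) w else 0).

Lemma gterm_expectation k : in_dim p k -> (d <= k)%N -> lam k < lam d0 ->
  expectation_le P (gterm k) (C * (lam k * tr / (n%:R * (lam d0 - lam k)))).
Proof.
move=> pk dk lkd; have lk0 := lam_gt0 pk.
have g0 : 0 < gap k by rewrite subr_gt0.
have t0 : 0 < gap k / (2 * lam d0) by rewrite divr_gt0// mulr_gt0.
apply: (@expectation_le_trans _ _ _ _ _
  (4 / gap k * (2 * C2 * lam k * tr / n%:R) +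
   gap k * (8 * C3 ^+ 2 * lam k * tr / (n%:R * gap k ^+ 2)))); last first.
  (* Here the constants add up to [C] exactly. *)
  rewrite le_eqVlt; apply/orP; left; apply/eqP; rewrite /C -/(gap k).
  by field; rewrite !gt_eqF.
apply: expectation_leD.
  by apply: expectation_leZ (deviation_norm_expectation pk); rewrite divr_ge0// ltW.
have c0 : 0 <= 8 * C3 ^+ 2 * lam k * tr / (n%:R * gap k ^+ 2).
  by rewrite divr_ge0 ?mulr_ge0 ?sqr_ge0 ?(ltW trace_gt0) ?ltW.
have [ld2|ld2] := boolP (lam d0 < 2 * lam k); last first.
  apply: expectation_le_trans (expectation_le_cst P (lexx 0)) _.
  by rewrite mulr_ge0// ltW.
apply: expectation_leZ; first exact: ltW.
exact: expectation_le_indic (measurable_white_event (ltW t0)) (white_event_prob pk dk lkd ld2).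
Qed.

Let lp := last_eigenvalue p lam.

Let lp_le k : in_dim p k -> lp <= lam k.
Proof. exact: last_eigenvalue_le lam_le lam_gt0. Qed.

Let B0_ind w : \1_B0 w = (w \in B0)%:R :> R. Proof. by rewrite indicE. Qed.

(** On [B0] the factor [a w k] is kept: its sum over [k] is at most [d], even when there are
    infinitely many [k]. *)
Lemma tail_term_le w k : in_dim p k -> (d <= k)%N ->
  (mu - lam k) * a w k <=
  (if lam k < lam d0 then gterm k w else 0) + (lam d0 - lp) * \1_B0 w * a w k.
Proof.
move=> pk dk; have a0 := overlap_ge0 w k.
have lp0 : 0 <= lam d0 - lp by rewrite subr_ge0 lp_le.
have B00 : 0 <= (lam d0 - lp) * \1_B0 w * a w k by rewrite !mulr_ge0// indicE.
case: ifPn => [lkd|]; last first.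
  rewrite -leNgt => lkd; rewrite add0r; apply: le_trans B00.
  by rewrite mulr_le0_ge0// subr_le0; apply: le_trans lkd.
have g0 : 0 < gap k by rewrite subr_gt0.
have i0 : 0 <= if lam d0 < 2 * lam k then gap k * \1_(B2 k) w else 0.
  by case: ifP => // _; rewrite mulr_ge0 ?indicE// ltW.
have d0' : 0 <= 4 / gap k * `|Delta w (u k)| ^+ 2.
  by rewrite mulr_ge0 ?sqr_ge0// divr_ge0// ltW.
apply: (@le_trans _ _ (gap k * a w k)); first by rewrite ler_wpM2r// lerD2r.
rewrite /gterm; case: (tail_event_caseP w pk dk lkd) => [h|[ld2 wB2]|wB0].
- apply: (@le_trans _ _ (4 / gap k * `|Delta w (u k)| ^+ 2)); last by lra.
  rewrite mulrAC ler_pdivlMr//; apply: le_trans h.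
  by rewrite le_eqVlt; apply/orP; left; apply/eqP; ring.
- rewrite ld2 in i0 *; rewrite [\1_(B2 k) w]indicE wB2 mulr1 in i0 *.
  have : gap k * a w k <= gap k by rewrite ler_piMr ?overlap_le1// ltW.
  by lra.
- rewrite B0_ind wB0 mulr1 in B00 *.
  have : gap k * a w k <= (lam d0 - lp) * a w k.
    by rewrite ler_wpM2r// lerD2l lerN2 lp_le.
  by lra.
Qed.

Lemma local_bound :
  ('E_P[risk]
   <= (C * \sum_(j < d | lam d < lam j) lam j * tr / (n%:R * (lam j - lam d)))%:E
      + C%:E * \sum_(d <= k <oo | in_dim p k && (lam k < lam d0)%R)
             (lam k * tr / (n%:R * (lam d0 - lam k)))%:E
      + ((lam d0 - lp) * expR (- (n%:R / (32 * C3 ^+ 2))))%:E)%E.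
Proof.
have lp0 : 0 <= lam d0 - lp by rewrite subr_ge0 lp_le.
pose h w := \sum_(j < d | lam d < lam j) hterm j w + (lam d0 - lp) * d%:R * \1_B0 w.
have hh : expectation_le P h
    (C * (\sum_(j < d | lam d < lam j) lam j * tr / (n%:R * (lam j - lam d)))
    + (lam d0 - lp) * expR (- (n%:R / (32 * C3 ^+ 2)))).
  apply: expectation_leD.
    by rewrite mulr_sumr; apply: expectation_le_sum => j lj; exact: head_term_expectation.
  apply: expectation_le_trans.
    apply: expectation_leZ; first by rewrite mulr_ge0.
    apply: expectation_le_indic (white_event_prob_quarter d_le).
    by apply: measurable_white_event; rewrite invr_ge0.
  (* The exponent is [2 z]; half of it absorbs the dimension, since [d <= 2 z <= exp z], and
     [exp(-z)] remains. *)
  rewrite -mulrA ler_wpM2l//; set z := n%:R / (32 * C3 ^+ 2).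
  have z0 : 0 <= z by rewrite divr_ge0// mulr_ge0// sqr_ge0.
  have E : n%:R / (16 * C3 ^+ 2) = z + z by rewrite /z; field; rewrite gt_eqF.
  rewrite E opprD expRD mulrA -[leRHS]mul1r ler_wpM2r ?expR_ge0//.
  rewrite expRN ler_pdivrMr ?expR_gt0// mul1r; apply: le_trans (expR_ge_double z0).
  by apply: le_trans d_le _; rewrite E; lra.
rewrite addeAC -EFinD -nneseriesZl; last first.
  move=> k /andP[pk lk]; have lk0 := lam_gt0 pk.
  by rewrite lee_fin divr_ge0 ?mulr_ge0 ?(ltW trace_gt0) ?subr_ge0 ?ltW.
under eq_eseriesr do rewrite -EFinM.
apply: (risk_expectation_le (Q := fun k => in_dim p k && (lam k < lam d0)) (g := gterm) hh).
  by move=> k dk /andP[pk lk]; exact: gterm_expectation.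
move=> w N.
have h1 : head w <= \sum_(j < d | lam d < lam j) hterm j w.
  rewrite /head [leRHS]big_mkcond; apply: ler_sum => j _.
  case: ifPn => [ldj|]; first exact: head_term_le.
  rewrite -leNgt => lj; rewrite mulr_le0_ge0 ?subr_le0//.
  by rewrite subr_ge0 overlap_le1// dim_lt.
have h2 : tail w N <= \sum_(d <= k < N | in_dim p k && (lam k < lam d0)) gterm k w
    + (lam d0 - lp) * d%:R * \1_B0 w.
  rewrite big_mkcondr/=.
  apply: (@le_trans _ _ (\sum_(d <= k < N | in_dim p k)
     ((if lam k < lam d0 then gterm k w else 0) + (lam d0 - lp) * \1_B0 w * a w k))).
    rewrite /tail big_nat_cond [leRHS]big_nat_cond; apply: ler_sum => k /andP[/andP[dk _] pk].
    exact: tail_term_le.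
  rewrite big_split/= lerD2l -mulr_sumr [leRHS]mulrAC ler_wpM2l ?sum_tail_overlap_le//.
  by rewrite mulr_ge0// indicE.
by rewrite /h; lra.
Qed.

(** * Gap-free estimates and the global bound *)

Lemma sum_le_tail_trace N : \sum_(d <= j < N | in_dim p j) lam j <= tail_trace p lam d.
Proof.
have nd : nondecreasing_seq (fun N => \sum_(d <= j < N | in_dim p j) lam j).
  apply/nondecreasing_seqP => m.
  have [dm|md] := leqP d m; last by rewrite !(@big_geq _ _ _ d) ?(ltnW md).
  rewrite [leRHS]big_mkcond big_nat_recr//= -big_mkcond/=.
  by rewrite lerDl; case: ifP => // /lam_gt0 /ltW.
apply: (nondecreasing_cvgn_le nd); apply: nondecreasing_is_cvgn => //.
exists tr => _ [M _ <-]; apply: le_trans (sum_eigenvalues_le_trace M).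
rewrite -(big_mkord (in_dim p) lam).
have lam_sum_ge0 m m' : 0 <= \sum_(m <= j < m' | in_dim p j) lam j.
  by apply: sumr_ge0 => j pj; rewrite ltW// lam_gt0.
have [dM|Md] := leqP d M; last by rewrite (@big_geq _ _ _ d M _ _ (ltnW Md)).
by rewrite [leRHS](big_cat_nat (n := d) _ dM)//= lerDr.
Qed.

(** [K * lam k] will bound the expectation of [zterm k], and [s] is the second term of the global
    bound, with [s^2 = d K tr_{>d}]. *)
Let K := C * tr / n%:R.
Let s := Num.sqrt (C * d%:R * tail_trace p lam d * tr / n%:R).

(* The term [k = d] does not occur in the sum; the room it leaves absorbs the
   contribution of the event [B0]. *)
Lemma tail_trace_ge N :
  mu + \sum_(d <= k < N | in_dim p k && (lam k < mu)) lam k <= tail_trace p lam d.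
Proof.
have tB := sum_le_tail_trace.
have lam_ge0 k : in_dim p k -> 0 <= lam k by move=> pk; rewrite ltW// lam_gt0.
have [Nd|dN] := leqP N d.
  rewrite (big_geq Nd) addr0; apply: le_trans (tB d.+1).
  by rewrite big_mkcond big_nat1 d_lt_p.
apply: le_trans (tB N); rewrite [leRHS]big_mkcond [X in _ + X <= _]big_mkcond.
rewrite !(@big_ltn _ _ _ d N)//=.
rewrite d_lt_p ltxx/= add0r lerD2l; apply: ler_sum => k _.
by case: (boolP (in_dim p k)) => //= pk; case: ifP => // _; exact: lam_ge0.
Qed.

Let trn_gt0 : 0 < tr / n%:R. Proof. by rewrite divr_gt0// trace_gt0. Qed.
Let K_gt0 : 0 < K. Proof. by rewrite /K -mulrA mulr_gt0. Qed.

Let tail_trace_gt0 : 0 < tail_trace p lam d.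
Proof.
by apply: lt_le_trans mu_gt0 _; have := tail_trace_ge 0; rewrite big_geq// addr0.
Qed.

Let s2_pos : 0 < C * d%:R * tail_trace p lam d * tr / n%:R.
Proof. by rewrite -mulrA; do 3!apply: mulr_gt0 => //; rewrite ltr0n. Qed.

Let sE : s ^+ 2 = d%:R * K * tail_trace p lam d.
Proof. by rewrite /s sqr_sqrtr ?ltW// /K; field; rewrite gt_eqF. Qed.

Let s_gt0 : 0 < s. Proof. by rewrite sqrtr_gt0. Qed.

(** A gap of at most [r] is itself the bound. For a larger gap [g], [hterm j] has expectation at
    most [r^2 / g <= r]. *)
Let fterm j w := let r := Num.sqrt (C * lam j * tr / n%:R) in
  if lam j - mu <= r then r else hterm j w.

Lemma fterm_expectation j : (j < d)%N ->
  expectation_le P (fterm j) (Num.sqrt (C * lam j * tr / n%:R)).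
Proof.
move=> jd; have lj0 := lam_gt0 (dim_lt jd).
have q0 : 0 < C * lam j * tr / n%:R by rewrite -mulrA; do 2!apply: mulr_gt0 => //.
rewrite /fterm /=; have [_|rg] := leP (lam j - mu) (Num.sqrt (C * lam j * tr / n%:R)).
  by apply: expectation_le_cst; exact: sqrtr_ge0.
have r0 : 0 < Num.sqrt (C * lam j * tr / n%:R) by rewrite sqrtr_gt0.
have g0 := lt_trans r0 rg.
apply: expectation_le_trans (head_term_expectation jd _) _; first by rewrite -subr_gt0.
rewrite (_ : C * _ = C * lam j * tr / n%:R / (lam j - mu)); last first.
  by rewrite /mu; field; rewrite !gt_eqF.
rewrite ler_pdivrMr// -[leLHS](sqr_sqrtr (ltW q0)) expr2.
by rewrite ler_wpM2l ?ltW.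
Qed.

Lemma head_fterm_le w j : (j < d)%N -> (lam j - mu) * (1 - a w j) <= fterm j w.
Proof.
move=> jd; rewrite /fterm /=; case: ifPn => [lr|].
  apply: le_trans lr; rewrite ler_piMr ?subr_ge0 ?gerBl ?overlap_ge0//.
  by apply: lam_le => //; exact: ltnW.
rewrite -ltNge => h; apply: head_term_le => //.
by rewrite -subr_gt0; apply: le_lt_trans h; exact: sqrtr_ge0.
Qed.

(** Bounds [(mu - lam k)^2 a w k] off [B0]. Since [mu - lam k <= gap k], the squared gap in the
    denominator of the probability of [B2 k] cancels, and no gap is left in the expectation. *)
Let zterm k w := 4 * `|Delta w (u k)| ^+ 2 +
  (if lam d0 < 2 * lam k then (mu - lam k) ^+ 2 * \1_(B2 k) w else 0).

Lemma zterm_expectation k : in_dim p k -> (d <= k)%N -> lam k < mu ->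
  expectation_le P (zterm k) (K * lam k).
Proof.
move=> pk dk lkm; have lk0 := lam_gt0 pk.
have lkd : lam k < lam d0 by exact: lt_le_trans mu_le.
have g0 : 0 < gap k by rewrite subr_gt0.
have t0 : 0 < gap k / (2 * lam d0) by rewrite divr_gt0// mulr_gt0.
apply: (@expectation_le_trans _ _ _ _ _
  (4 * (2 * C2 * lam k * tr / n%:R) + 8 * C3 ^+ 2 * lam k * tr / n%:R)); last first.
  rewrite le_eqVlt; apply/orP; left; apply/eqP; rewrite /K /C.
  by field; rewrite !gt_eqF.
apply: expectation_leD.
  by apply: expectation_leZ (deviation_norm_expectation pk).
have c0 : 0 <= 8 * C3 ^+ 2 * lam k * tr / n%:R.
  by rewrite -mulrA mulr_ge0 ?(ltW trn_gt0)// mulr_ge0 ?(ltW lk0)// mulr_ge0 ?sqr_ge0.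
have [ld2|ld2] := boolP (lam d0 < 2 * lam k); last first.
  by apply: expectation_le_trans (expectation_le_cst P (lexx 0)) _.
apply: expectation_le_trans.
  apply: expectation_leZ; first exact: sqr_ge0.
  exact: expectation_le_indic (measurable_white_event (ltW t0)) (white_event_prob pk dk lkd ld2).
rewrite -/(gap k) (_ : _ * _ =
  (mu - lam k) ^+ 2 / gap k ^+ 2 * (8 * C3 ^+ 2 * lam k * tr / n%:R)).
  rewrite ler_piMl// ler_pdivrMr ?exprn_gt0// mul1r lerXn2r ?nnegrE ?(ltW g0)//.
    by rewrite subr_ge0 ltW.
  by rewrite /gap lerD2r.
by field; rewrite !gt_eqF.
Qed.

(* AM-GM: [2 (mu - lam k) a <= (d/s) (mu - lam k)^2 a + (s/d) a]; summing over k
   and using [sum a = d] is the Cauchy-Schwarz step, linearized so that expectations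
   can be taken without Jensen's inequality. *)
Lemma tail_zterm_le w k : in_dim p k -> (d <= k)%N -> w \notin B0 ->
  (mu - lam k) * a w k <=
  (if lam k < mu then d%:R / (2 * s) * zterm k w else 0) + s / (2 * d%:R) * a w k.
Proof.
move=> pk dk wB0; have a0 := overlap_ge0 w k.
have d0' : 0 < d%:R :> R by rewrite ltr0n.
have c0 : 0 <= s / (2 * d%:R) * a w k by rewrite mulr_ge0// divr_ge0// ltW// mulr_gt0.
case: ifPn => [lkm|]; last first.
  rewrite -leNgt => lkm; rewrite add0r; apply: le_trans c0.
  by rewrite mulr_le0_ge0// subr_le0.
have lkd : lam k < lam d0 by exact: lt_le_trans mu_le.
have mg : (mu - lam k) ^+ 2 <= gap k ^+ 2.
  have g0 : 0 < gap k by rewrite subr_gt0.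
  have m0 : 0 < mu - lam k by rewrite subr_gt0.
  by rewrite lerXn2r ?nnegrE ?(ltW g0) ?(ltW m0)// /gap lerD2r.
have z_le : (mu - lam k) ^+ 2 * a w k <= zterm k w.
  have D0 : 0 <= `|Delta w (u k)| ^+ 2 by exact: sqr_ge0.
  rewrite /zterm; case: (tail_event_caseP w pk dk lkd) => [h|[ld2 wB2]|].
  3: by rewrite (negbTE wB0).
  - apply: (@le_trans _ _ (gap k ^+ 2 * a w k)); first by rewrite ler_wpM2r.
    apply: le_trans h _; rewrite lerDl; case: ifP => // _.
    by rewrite mulr_ge0 ?sqr_ge0// indicE.
  - rewrite ld2 [\1_(B2 k) w]indicE wB2 mulr1.
    apply: (@le_trans _ _ ((mu - lam k) ^+ 2)); last by rewrite lerDr mulr_ge0.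
    by rewrite ler_piMr ?sqr_ge0 ?overlap_le1.
have r0 : 0 < d%:R / (2 * s) by rewrite divr_gt0// mulr_gt0.
apply: (@le_trans _ _ (d%:R / (2 * s) * ((mu - lam k) ^+ 2 * a w k) + s / (2 * d%:R) * a w k)).
  rewrite mulrA -mulrDl ler_wpM2r// -subr_ge0.
  rewrite (_ : _ - _ = d%:R / (2 * s) * (mu - lam k - s / d%:R) ^+ 2).
    by rewrite mulr_ge0 ?sqr_ge0// ltW.
  by field; rewrite !gt_eqF.
by rewrite lerD2r ler_wpM2l// ltW.
Qed.

(** Off [B0] the linearized bounds are summed, and the overlaps contribute at most [s / 2]. On [B0]
    the tail is at most [mu * d]. *)
Lemma tail_le_mean_square w N :
  tail w N <= \sum_(d <= k < N | in_dim p k && (lam k < mu)) d%:R / (2 * s) * zterm k w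
    + d%:R / (2 * s) * (d%:R * mu ^+ 2 * \1_B0 w) + s / 2.
Proof.
have d0' : 0 < d%:R :> R by rewrite ltr0n.
have r0 : 0 < d%:R / (2 * s) by rewrite divr_gt0// mulr_gt0.
have z0 k : 0 <= zterm k w.
  apply: addr_ge0; first by rewrite mulr_ge0 ?sqr_ge0.
  by case: ifP => // _; rewrite mulr_ge0 ?sqr_ge0// indicE.
have [wB0|wB0] := boolP (w \in B0); rewrite indicE.
  rewrite wB0 mulr1 -[leLHS]add0r -addrA; apply: lerD.
    by apply: sumr_ge0 => k _; rewrite mulr_ge0 ?z0 ?ltW.
  apply: (@le_trans _ _ (mu * d%:R)).
    apply: (@le_trans _ _ (\sum_(d <= k < N | in_dim p k) mu * a w k)).
      apply: ler_sum => k pk; rewrite ler_wpM2r ?overlap_ge0//.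
      by rewrite gerBl ltW// lam_gt0.
    by rewrite -mulr_sumr ler_wpM2l ?sum_tail_overlap_le// ltW.
  (* The same linearization applied to the product [d * mu]. *)
  rewrite -subr_ge0 (_ : _ - _ = (2 * s)^-1 * (d%:R * mu - s) ^+ 2).
    by rewrite mulr_ge0 ?sqr_ge0// invr_ge0 mulr_ge0// ltW.
  by field; rewrite gt_eqF.
rewrite (negbTE wB0) !mulr0 addr0 big_mkcondr/=.
apply: (@le_trans _ _ (\sum_(d <= k < N | in_dim p k)
   ((if lam k < mu then d%:R / (2 * s) * zterm k w else 0) + s / (2 * d%:R) * a w k))).
  rewrite /tail big_nat_cond [leRHS]big_nat_cond; apply: ler_sum => k /andP[/andP[dk _] pk].
  exact: tail_zterm_le.
rewrite big_split/= lerD2l -mulr_sumr.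
apply: (@le_trans _ _ (s / (2 * d%:R) * d%:R)).
  by rewrite ler_wpM2l ?sum_tail_overlap_le// divr_ge0 ?mulr_ge0 ?ltW.
by rewrite le_eqVlt; apply/orP; left; apply/eqP; field; rewrite gt_eqF.
Qed.

(** With [y = n / (16 C3^2)], [exp(-y) <= 1 / (2 y) = 8 C3^2 / n] and [d mu <= tr]. The result has
    the size of a term [K * lam k] at [k = d]. *)
Lemma quarter_event_expectation :
  expectation_le P (fun w => d%:R * mu ^+ 2 * \1_B0 w) (K * mu).
Proof.
apply: expectation_le_trans.
  apply: expectation_leZ; first by rewrite mulr_ge0 ?sqr_ge0.
  apply: expectation_le_indic (white_event_prob_quarter d_le).
  by apply: measurable_white_event; rewrite invr_ge0.
set y := n%:R / (16 * C3 ^+ 2).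
have y0 : 0 < y by rewrite divr_gt0// mulr_gt0// exprn_gt0.
have ey : expR (- y) <= 8 * C3 ^+ 2 / n%:R.
  rewrite expRN (_ : 8 * C3 ^+ 2 / n%:R = (2 * y)^-1); last first.
    by rewrite /y; field; rewrite !gt_eqF.
  have y2 : 0 < 2 * y by rewrite mulr_gt0.
  by rewrite lef_pV2 ?posrE ?expR_gt0//; exact: expR_ge_double (ltW y0).
have dm : d%:R * mu <= tr.
  by apply: le_trans dim_eigenvalue_le_trace; rewrite ler_wpM2l.
have tr0 := trace_gt0.
apply: (@le_trans _ _ (tr * mu * (8 * C3 ^+ 2 / n%:R))).
  apply: ler_pM; last exact: ey.
  - by rewrite mulr_ge0 ?sqr_ge0.
  - exact: expR_ge0.
  - by rewrite expr2 mulrA ler_wpM2r ?(ltW mu_gt0).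
rewrite (_ : tr * mu * (8 * C3 ^+ 2 / n%:R) = 8 * C3 ^+ 2 * (tr / n%:R * mu)); last by ring.
rewrite /K -(mulrA C tr) -(mulrA C _ mu) ler_wpM2r//.
  by rewrite mulr_ge0 ?(ltW trn_gt0)// ltW.
by rewrite /C lerDr mulr_ge0// ltW.
Qed.

Lemma global_bound :
  ('E_P[risk]
   <= (\sum_(j < d) Num.sqrt (C * lam j * tr / n%:R)
       + Num.sqrt (C * d%:R * tail_trace p lam d * tr / n%:R))%:E)%E.
Proof.
have d0' : 0 < d%:R :> R by rewrite ltr0n.
have r0 : 0 < d%:R / (2 * s) by rewrite divr_gt0// mulr_gt0.
pose h w := \sum_(j < d) fterm j w + (d%:R / (2 * s) * (d%:R * mu ^+ 2 * \1_B0 w) + s / 2).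
have hh : expectation_le P h (\sum_(j < d) Num.sqrt (C * lam j * tr / n%:R)
    + (d%:R / (2 * s) * (K * mu) + s / 2)).
  apply: expectation_leD.
    by apply: expectation_le_sum => j _; exact: fterm_expectation.
  apply: expectation_leD.
    by apply: expectation_leZ; [exact: ltW|exact: quarter_event_expectation].
  by apply: expectation_le_cst; rewrite divr_ge0// ltW.
apply: le_trans.
  apply: (risk_expectation_le (Q := fun k => in_dim p k && (lam k < mu))
    (g := fun k w => d%:R / (2 * s) * zterm k w)
    (cg := fun k => d%:R / (2 * s) * (K * lam k)) hh).
    move=> k dk /andP[pk lk]; apply: expectation_leZ; first exact: ltW.
    exact: zterm_expectation.
  move=> w N; have := tail_le_mean_square w N.
  have : head w <= \sum_(j < d) fterm j w by apply: ler_sum => j _; exact: head_fterm_le.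
  by rewrite /h; lra.
have series_le : (\sum_(d <= k <oo | in_dim p k && (lam k < mu)%R)
      (d%:R / (2 * s) * (K * lam k))%:E
    <= (d%:R / (2 * s) * (K * (tail_trace p lam d - mu)))%:E)%E.
  apply: nneseries_le_bound => [k /andP[pk _]|N].
    by rewrite mulr_ge0 ?(ltW r0)// mulr_ge0 ?(ltW K_gt0)// ltW// lam_gt0.
  rewrite -!mulr_sumr !ler_wpM2l ?(ltW r0) ?(ltW K_gt0)// lerBrDl.
  exact: tail_trace_ge.
apply: le_trans (leeD (lexx _) series_le) _.
rewrite -EFinD lee_fin -/s -addrA lerD2l.
rewrite le_eqVlt; apply/orP; left; apply/eqP.
(* The contribution [K * mu] of [B0] completes the tail trace, and [s^2 / (2 s) + s / 2 = s]. *)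
have -> : d%:R / (2 * s) * (K * mu) + s / 2 + d%:R / (2 * s) * (K * (tail_trace p lam d - mu)) =
  (d%:R * K * tail_trace p lam d) / (2 * s) + s / 2 by ring.
by rewrite -sE; field; rewrite gt_eqF.
Qed.

End pca.

Theorem theorem2p9 (R : realType)
    (H : completeNormedModType R) (ip : {dot H for idfun}) (p : option nat)
    (disp : measure_display) (Omega : measurableType disp)
    (P : probability Omega R) (X : Omega -> H) (Sigma : H -> H)
    (lam : nat -> R) (u : nat -> H)
    (n : nat) (Xs : 'I_n -> Omega -> H)
    (hlam : Omega -> nat -> R) (hu : Omega -> nat -> H)
    (d : nat) (C1 C2 C3 : R)
    (ip_norm : hilbert_norm ip)
    (X_meas : borel_measurable X)
    (X_sq : square_integrable P X)
    (X_centered : is_mean ip P X 0)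
    (Sigma_cov : is_covariance ip P X Sigma)
    (Sigma_spec : spectral_decomposition ip p Sigma lam u)
    (lam_gt0 : forall j, in_dim p j -> 0 < lam j)
    (n_ge1 : (1 <= n)%N)
    (Xs_copies : independent_copies P X Xs)
    (hSigma_spec : forall w,
       spectral_decomposition ip p (sample_covariance ip Xs w) (hlam w) (hu w))
    (hlam_ge0 : forall w j, in_dim p j -> 0 <= hlam w j)
    (d_ge1 : (1 <= d)%N) (d_lt_p : in_dim p d)
    (risk_meas : measurable_fun setT (excess_risk ip p Sigma u hu d))
    (C2_def : smallest_fourth_moment_constant ip P p u lam Sigma Xs C2)
    (C3_gt1 : 1 < C3) (C3_def : koltchinskii_lounici C1 C3)
    (X_subG : sub_gaussian ip P C1 X)
    (d_le : d%:R <= n%:R / (16 * C3 ^+ 2)) :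
  let C := 8 * C2 + 8 * C3 ^+ 2 in
  let tr := trace ip p u Sigma in
  ('E_P[excess_risk ip p Sigma u hu d]
   <= (C * \sum_(j < d | lam d < lam j)
             lam j * tr / (n%:R * (lam j - lam d)))%:E
      + C%:E * \sum_(d <= k <oo | in_dim p k && (lam k < lam d.-1)%R)
             (lam k * tr / (n%:R * (lam d.-1 - lam k)))%:E
      + ((lam d.-1 - last_eigenvalue p lam)
         * expR (- (n%:R / (32 * C3 ^+ 2))))%:E)%E
  /\
  ('E_P[excess_risk ip p Sigma u hu d]
   <= (\sum_(j < d) Num.sqrt (C * lam j * tr / n%:R)
       + Num.sqrt (C * d%:R * tail_trace p lam d * tr / n%:R))%:E)%E.
Proof.
move=> C tr; have [C2_gt0 C2_bound _] := C2_def.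
case: d d_ge1 d_lt_p risk_meas d_le => // d0 _ d_lt_p' risk_meas' d_le'; split.
  exact: (local_bound ip_norm X_meas X_sq X_centered Sigma_cov Sigma_spec lam_gt0 n_ge1
    Xs_copies hSigma_spec d_lt_p' C3_gt1 C3_def X_subG C2_gt0 C2_bound risk_meas' d_le').
exact: (global_bound ip_norm X_meas X_sq X_centered Sigma_cov Sigma_spec lam_gt0 n_ge1
  Xs_copies hSigma_spec d_lt_p' C3_gt1 C3_def X_subG C2_gt0 C2_bound risk_meas' d_le').
Qed.
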